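(* Let $G=(G_1,\ldots,G_p):(\mathbb{R}^m,0)\to(\mathbb{R}^p,0)$, $m>p\ge2$, be a real analytic map germ, and suppose that $\det D(x)>0$ for all $x\in M(G)\setminus(V_G\cup\mathrm{Sing}\,G)$ (in a small neighbourhood of $0$). Then $a(x)>0$ for all such $x$. In particular, if $\mathrm{Disc}\,G=\{0\}$, then there exists a Milnor vector field for $G$ on $B^m_\varepsilon\setminus V_G$ for some small $\varepsilon>0$, and $\Psi_G$ is $\rho$-regular.
   Context: $\rho(x)=\|x\|^2$, $V_G=G^{-1}(0)$, $\mathrm{Sing}\,G=\{x:\mathrm{rank}\,JG(x)<p\}$, $\mathrm{Disc}\,G=G(\mathrm{Sing}\,G)$ as a set germ at $0$. $M(G)$ is the germ at $0$ of the closure of the set of points $x$ where $\nabla\rho(x),\nabla G_1(x),\ldots,\nabla G_p(x)$ are linearly dependent. For $x\in M(G)\setminus(V_G\cup\mathrm{Sing}\,G)$, $a(x)$ is the unique real number with $\nabla\rho(x)-a(x)\nabla\|G(x)\|^2\in W(x):=\{\sum_ic_i\nabla G_i(x): c\in\mathbb{R}^p,\ \sum_ic_iG_i(x)=0\}$. On $\{G_1\ne0\}$ (analogously on $\{G_j\ne0\}$ with index $j$ playing the role of $1$), $\Omega_k=G_1\nabla G_k-G_k\nabla G_1$, $k=2,\dots,p$, span $W(x)$, and $D(x)$ is the $p\times p$ matrix whose first column is $(\langle\nabla\rho,\nabla\|G\|^2\rangle,\langle\nabla\rho,\Omega_2\rangle,\ldots,\langle\nabla\rho,\Omega_p\rangle)^t$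 and whose $(i,j)$ entry for $j\ge2$ is $\langle\Omega_j,w_i\rangle$, where $(w_1,\ldots,w_p)=(\nabla\|G\|^2,\Omega_2,\ldots,\Omega_p)$. $\Psi_G=G/\|G\|:U\setminus V_G\to S^{p-1}$. $M(\Psi_G)$ is the germ at $0$ of the closure of the set of $x\in U\setminus V_G$ at which $(\rho,\Psi_G):U\setminus V_G\to\mathbb{R}\times S^{p-1}$ is not a submersion; $\Psi_G$ is $\rho$-regular if $M(\Psi_G)\setminus G^{-1}(\mathrm{Disc}\,G)=\emptyset$. When $\mathrm{Disc}\,G=\{0\}$, a Milnor vector field for $G$ on $B^m_\varepsilon\setminus V_G$ is a vector field $\nu$ such that for every $x\in B^m_\varepsilon\setminus V_G$: $\nu(x)$ is tangent to the fibre $\Psi_G^{-1}(\Psi_G(x))$, $\langle\nu(x),\nabla\rho(x)\rangle>0$, and $\langle\nu(x),\nabla\|G(x)\|^2\rangle>0$. *)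

(* Defs.v *)
(* classical real numbers. Points of R^m are functions nat -> R
   vanishing at coordinates >= m (predicate inRm). Indices are 0-based:
   the paper's G_1..G_p are G 0 .. G (p-1). *)
From Stdlib Require Import Reals Lra List Classical ClassicalEpsilon.
Import ListNotations.
Open Scope R_scope.

Definition pt := nat -> R.
Definition inRm (m : nat) (x : pt) : Prop := forall i, (m <= i)%nat -> x i = 0.

Fixpoint sumR (n : nat) (f : nat -> R) : R :=
  match n with O => 0 | S k => sumR k f + f k end.

Definition dot (m : nat) (u v : pt) : R := sumR m (fun i => u i * v i).
Definition rho (m : nat) (x : pt) : R := dot m x x.
Definition norm (m : nat) (x : pt) : R := sqrt (rho m x).
Definition zero_pt : pt := fun _ => 0.
Definition basis (j : nat) : pt := fun i => if Nat.eqb i j then 1 else 0.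

Definition has_partial (f : pt -> R) (x : pt) (j : nat) (l : R) : Prop :=
  derivable_pt_lim (fun t => f (fun i => x i + t * basis j i)) 0 l.
Definition pd (f : pt -> R) (x : pt) (j : nat) : R :=
  epsilon (inhabits 0) (fun l => has_partial f x j l).
Definition grad (m : nat) (f : pt -> R) (x : pt) : pt :=
  fun j => if Nat.ltb j m then pd f x j else 0.

Definition cont_at (m : nat) (f : pt -> R) (x : pt) : Prop :=
  forall eps, 0 < eps -> exists d, 0 < d /\ forall y, inRm m y ->
    norm m (fun i => y i - x i) < d -> Rabs (f y - f x) < eps.
Fixpoint Ck (m k : nat) (U : pt -> Prop) (f : pt -> R) : Prop :=
  match k with
  | O => forall x, inRm m x -> U x -> cont_at m f x
  | S k' => (forall x, inRm m x -> U x -> forall j, (j < m)%nat ->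
               exists l, has_partial f x j l)
            /\ forall j, (j < m)%nat -> Ck m k' U (fun x => pd f x j)
  end.
Definition smooth_on (m : nat) (U : pt -> Prop) (f : pt -> R) : Prop :=
  forall k, Ck m k U f.

Fixpoint mons (m d : nat) : list (list nat) :=
  match m with
  | O => match d with O => [nil] | _ => nil end
  | S m' => flat_map (fun k => map (cons k) (mons m' (d - k))) (seq 0 (S d))
  end.
Fixpoint monom (a : list nat) (x : pt) (k : nat) : R :=
  match a with nil => 1 | a0 :: a' => x k ^ a0 * monom a' x (S k) end.
Definition hom_part (c : list nat -> R) (m d : nat) (x : pt) : R :=
  fold_right Rplus 0 (map (fun a => c a * monom a x 0) (mons m d)).
Definition hom_abs (c : list nat -> R) (m d : nat) (x : pt) : R :=
  fold_right Rplus 0 (map (fun a => Rabs (c a * monom a x 0)) (mons m d)).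
Definition analytic_at0 (m : nat) (f : pt -> R) : Prop :=
  exists r, 0 < r /\ exists c : list nat -> R,
    forall x, inRm m x -> norm m x < r ->
      (exists s, infinite_sum (fun d => hom_abs c m d x) s) /\
      infinite_sum (fun d => hom_part c m d x) (f x).

Definition normG2 (p : nat) (G : nat -> pt -> R) (x : pt) : R :=
  sumR p (fun i => G i x ^ 2).
Definition VG (p : nat) (G : nat -> pt -> R) (x : pt) : Prop :=
  forall i, (i < p)%nat -> G i x = 0.
Definition lincomb (n : nat) (c : nat -> R) (v : nat -> pt) : pt :=
  fun k => sumR n (fun i => c i * v i k).
(* rank JG(x) < p  <->  the p rows grad G_i(x) are linearly dependent *)
Definition SingG (m p : nat) (G : nat -> pt -> R) (x : pt) : Prop :=
  exists c : nat -> R, (exists i, (i < p)%nat /\ c i <> 0) /\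
    forall k, (k < m)%nat -> lincomb p c (fun i => grad m (G i) x) k = 0.

Definition closure_at (m : nat) (A : pt -> Prop) (x : pt) : Prop :=
  forall eps, 0 < eps -> exists y, inRm m y /\
    norm m (fun i => y i - x i) < eps /\ A y.

Definition depset (m p : nat) (G : nat -> pt -> R) (y : pt) : Prop :=
  exists c : nat -> R, (exists i, (i <= p)%nat /\ c i <> 0) /\
    forall k, (k < m)%nat ->
      lincomb (S p) c (fun i => match i with
                                | O => grad m (rho m) y
                                | S i' => grad m (G i') y end) k = 0.
Definition MG (m p : nat) (G : nat -> pt -> R) (x : pt) : Prop :=
  closure_at m (depset m p G) x.

Definition in_W (m p : nat) (G : nat -> pt -> R) (x : pt) (v : pt) : Prop :=
  exists c : nat -> R, sumR p (fun i => c i * G i x) = 0 /\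
    forall k, (k < m)%nat -> v k = lincomb p c (fun i => grad m (G i) x) k.
Definition a_prop (m p : nat) (G : nat -> pt -> R) (x : pt) (a : R) : Prop :=
  in_W m p G x (fun k => grad m (rho m) x k - a * grad m (normG2 p G) x k).
Definition acoef (m p : nat) (G : nat -> pt -> R) (x : pt) : R :=
  epsilon (inhabits 0) (a_prop m p G x).

(* Omega_k = G_j grad G_k - G_k grad G_j, and the matrix D(x) built with
   index j playing the role of the paper's index 1 *)
Definition Omega (m : nat) (G : nat -> pt -> R) (j k : nat) (x : pt) : pt :=
  fun i => G j x * grad m (G k) x i - G k x * grad m (G j) x i.
(* l-th element (l >= 1) of the increasing enumeration of indices <> j *)
Definition kidx (j l : nat) : nat := if Nat.ltb (l - 1) j then (l - 1)%nat else l.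
Definition wvec (m p : nat) (G : nat -> pt -> R) (j : nat) (x : pt) (l : nat) : pt :=
  match l with O => grad m (normG2 p G) x | S _ => Omega m G j (kidx j l) x end.
Definition Dmat (m p : nat) (G : nat -> pt -> R) (j : nat) (x : pt) : nat -> nat -> R :=
  fun i c => match c with
             | O => dot m (grad m (rho m) x) (wvec m p G j x i)
             | S _ => dot m (wvec m p G j x c) (wvec m p G j x i) end.

Fixpoint det (n : nat) (A : nat -> nat -> R) : R :=
  match n with
  | O => 1
  | S n' => sumR (S n') (fun c => (-1) ^ c * A O c *
               det n' (fun i j => A (S i) (if Nat.ltb j c then j else S j)))
  end.

Definition Psi (p : nat) (G : nat -> pt -> R) (i : nat) (x : pt) : R :=
  G i x / sqrt (normG2 p G x).
(* d(rho, Psi_G)(x) : R^m -> R x T_{Psi(x)} S^{p-1} is surjective *)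
Definition submersion_rhoPsi (m p : nat) (G : nat -> pt -> R) (x : pt) : Prop :=
  forall (s : R) (u : pt), dot p u (fun i => Psi p G i x) = 0 ->
    exists v, inRm m v /\ dot m (grad m (rho m) x) v = s /\
      forall i, (i < p)%nat -> dot m (grad m (Psi p G i) x) v = u i.
Definition MPsi (m p : nat) (G : nat -> pt -> R) (x : pt) : Prop :=
  closure_at m (fun y => ~ VG p G y /\ ~ submersion_rhoPsi m p G y) x.

(* Disc G = {0} as a set germ: 0 in Sing G and Sing G is contained in V_G near 0 *)
Definition DiscG_zero (m p : nat) (G : nat -> pt -> R) : Prop :=
  SingG m p G zero_pt /\
  exists d, 0 < d /\ forall x, inRm m x -> norm m x < d -> SingG m p G x -> VG p G x.

(* M(Psi_G) \ G^{-1}(Disc G) is empty as a germ *)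
Definition rho_regular (m p : nat) (G : nat -> pt -> R) : Prop :=
  exists eps, 0 < eps /\ forall x, inRm m x -> norm m x < eps -> MPsi m p G x ->
    exists y, inRm m y /\ norm m y < eps /\ SingG m p G y /\
      forall i, (i < p)%nat -> G i y = G i x.

Definition milnor_vf (m p : nat) (G : nat -> pt -> R) (eps : R) (nu : pt -> pt) : Prop :=
  let U := fun x => norm m x < eps /\ ~ VG p G x in
  (forall k, (k < m)%nat -> smooth_on m U (fun x => nu x k)) /\
  forall x, inRm m x -> U x ->
    inRm m (nu x) /\
    (forall i, (i < p)%nat -> dot m (grad m (Psi p G i) x) (nu x) = 0) /\
    0 < dot m (nu x) (grad m (rho m) x) /\
    0 < dot m (nu x) (grad m (normG2 p G) x).

(* Main.v *)
Require Import Defs.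
From Stdlib Require Import Reals Lra Lia List Classical ClassicalEpsilon FunctionalExtensionality.
From Coquelicot Require Coquelicot.
From mathcomp Require all_boot all_order all_algebra Rstruct.
Import ListNotations.
Open Scope R_scope.

(* At a point of M(G) outside V_G and Sing G one has grad rho = a grad |G|^2 + w with w in W, and w
   is a combination of the Omega_k. Hence D is the Gram matrix of (grad |G|^2, Omega_2, .., Omega_p)
   multiplied by an identity matrix whose first column is replaced by (a, ..), so that
   det D = a det(Gram); Gram determinants are nonnegative, so det D > 0 forces a > 0.

   If Disc G = {0}, the gradients of the G_k are independent off V_G near 0. Let v be their
   combination with <v, grad G_k> = G_k and r the component of grad rho orthogonal to all of them.
   Any mu v + lam r is tangent to the fibres of Psi_G, and r vanishes exactly on M(G), where
   <v, grad rho> = 2 a |G|^2 > 0; smooth mu > 0 and lam then give a Milnor vector field. Correcting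
   along it solves the submersion equations for (rho, Psi_G), so M(Psi_G) is contained in V_G. *)

(** * Calculus of partial derivatives on R^m *)

(** The field has to be given by one formula, smooth on the whole punctured ball. The vectors v and
    r solve linear systems in the independent gradients, so Gram-Schmidt is carried out over the
    smooth functions and yields smooth coefficients. The root of b^2 + R^2, with b and R the
    derivatives of rho along v and r, is smooth because b > 0 wherever R = 0; this is where the sign
    of a enters the construction. Every combination mu v + lam r is carried by DG to mu G. Hence the
    tangency to the fibres of Psi_G and the growth of |G|^2 when mu > 0, while lam is free to repair
    the derivative of rho where b <= 0. M(G) is a closure, but the algebra needs a linear dependence
    at the point itself; openness of linear independence closes this gap. Points of V_G are harmless
    for rho-regularity: there G takes the value G(0) = 0, and 0 is singular. *)

Lemma sumR_ext (n : nat) (f g : nat -> R) :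
  (forall i, (i < n)%nat -> f i = g i) -> sumR n f = sumR n g.
Proof.
  induction n as [|n IH]; intros H; [reflexivity|]. simpl.
  rewrite IH, (H n); [reflexivity | lia | intros i Hi; apply H; lia].
Qed.

Lemma sumR_plus (n : nat) (f g : nat -> R) :
  sumR n (fun i => f i + g i) = sumR n f + sumR n g.
Proof. induction n as [|n IH]; simpl; [lra | rewrite IH; lra]. Qed.

Lemma sumR_scal (n : nat) (a : R) (f : nat -> R) :
  sumR n (fun i => a * f i) = a * sumR n f.
Proof. induction n as [|n IH]; simpl; [lra | rewrite IH; lra]. Qed.

Lemma sumR_zero (n : nat) (f : nat -> R) :
  (forall i, (i < n)%nat -> f i = 0) -> sumR n f = 0.
Proof.
  induction n as [|n IH]; intros H; [reflexivity|]. simpl.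
  rewrite IH, (H n); [lra | lia | intros i Hi; apply H; lia].
Qed.

Lemma sumR_swap (n k : nat) (f : nat -> nat -> R) :
  sumR n (fun i => sumR k (fun j => f i j)) = sumR k (fun j => sumR n (fun i => f i j)).
Proof.
  induction n as [|n IH]; simpl.
  - symmetry; apply sumR_zero; reflexivity.
  - rewrite IH, <- sumR_plus; reflexivity.
Qed.

Lemma sumR_le (n : nat) (f g : nat -> R) :
  (forall i, (i < n)%nat -> f i <= g i) -> sumR n f <= sumR n g.
Proof.
  induction n as [|n IH]; intros H; simpl; [lra|].
  apply Rplus_le_compat; [apply IH; intros i Hi|]; apply H; lia.
Qed.

Lemma sumR_const (n : nat) (a : R) : sumR n (fun _ => a) = INR n * a.
Proof. induction n as [|n IH]; [simpl; lra|]. rewrite S_INR; simpl; rewrite IH; lra. Qed.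

Lemma sumR_ge0 (n : nat) (f : nat -> R) :
  (forall i, (i < n)%nat -> 0 <= f i) -> 0 <= sumR n f.
Proof.
  intros H. apply Rle_trans with (sumR n (fun _ => 0)).
  - rewrite sumR_const; lra.
  - apply sumR_le; exact H.
Qed.

Lemma sumR_term_le (n : nat) (f : nat -> R) (i : nat) :
  (forall i, (i < n)%nat -> 0 <= f i) -> (i < n)%nat -> f i <= sumR n f.
Proof.
  induction n as [|n IH]; intros H Hi; [lia|]. simpl.
  assert (Hn := sumR_ge0 n f ltac:(intros; apply H; lia)).
  assert (Hf := H n ltac:(lia)).
  destruct (Nat.eq_dec i n) as [->|]; [lra|].
  assert (f i <= sumR n f) by (apply IH; [intros; apply H; lia | lia]). lra.
Qed.

Lemma sumR_abs (n : nat) (f : nat -> R) : Rabs (sumR n f) <= sumR n (fun i => Rabs (f i)).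
Proof.
  induction n as [|n IH]; simpl; [rewrite Rabs_R0; lra|].
  eapply Rle_trans; [apply Rabs_triang|]. lra.
Qed.

(** * Scalar product and norm *)

Lemma dot_sym (m : nat) (u v : pt) : dot m u v = dot m v u.
Proof. apply sumR_ext; intros; ring. Qed.

Lemma dot_ext_l (m : nat) (u u' v : pt) :
  (forall k, (k < m)%nat -> u k = u' k) -> dot m u v = dot m u' v.
Proof. intros H; apply sumR_ext; intros; rewrite H by assumption; ring. Qed.

Lemma dot_comb_l (m : nat) (a b : R) (u v w : pt) :
  dot m (fun k => a * u k + b * v k) w = a * dot m u w + b * dot m v w.
Proof.
  unfold dot. rewrite <- !sumR_scal, <- sumR_plus. apply sumR_ext; intros; ring.
Qed.

Lemma dot_lincomb_l (m n : nat) (c : nat -> R) (v : nat -> pt) (u : pt) :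
  dot m (lincomb n c v) u = sumR n (fun i => c i * dot m (v i) u).
Proof.
  unfold dot, lincomb.
  rewrite (sumR_ext n _ (fun i => sumR m (fun k => c i * v i k * u k))).
  - rewrite sumR_swap. apply sumR_ext; intros k _.
    rewrite Rmult_comm, <- sumR_scal. apply sumR_ext; intros; ring.
  - intros i _. rewrite <- sumR_scal. apply sumR_ext; intros; ring.
Qed.

Lemma dot_self_ge0 (m : nat) (u : pt) : 0 <= dot m u u.
Proof. apply sumR_ge0; intros; nra. Qed.

Lemma dot_self_eq0 (m : nat) (u : pt) :
  dot m u u = 0 -> forall k, (k < m)%nat -> u k = 0.
Proof.
  intros H k Hk.
  assert (u k * u k <= dot m u u)
    by (apply (sumR_term_le m (fun i => u i * u i)); [intros; nra | assumption]).
  nra.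
Qed.

Lemma abs_le_norm (m : nat) (x : pt) (i : nat) : (i < m)%nat -> Rabs (x i) <= norm m x.
Proof.
  intros Hi. unfold norm. rewrite <- sqrt_Rsqr_abs. apply sqrt_le_1_alt.
  apply (sumR_term_le m (fun i => x i * x i)); [intros; nra | assumption].
Qed.

Lemma norm_ge0 (m : nat) (x : pt) : 0 <= norm m x.
Proof. apply sqrt_pos. Qed.

Lemma norm_lt_rho (m : nat) (x : pt) (r : R) : 0 < r -> norm m x < r <-> rho m x < r * r.
Proof.
  intros Hr. unfold norm. rewrite <- (sqrt_square r) at 1 by lra. split; intros H.
  - apply sqrt_lt_0_alt; assumption.
  - apply sqrt_lt_1_alt; split; [apply dot_self_ge0 | assumption].
Qed.

Lemma norm_zero (m : nat) (x : pt) : (forall i, (i < m)%nat -> x i = 0) -> norm m x = 0.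
Proof.
  intros H. unfold norm, rho, dot. rewrite sumR_zero, sqrt_0; [reflexivity|].
  intros i Hi; rewrite H by assumption; ring.
Qed.

Lemma norm_shift (m : nat) (x : pt) (j : nat) (t : R) :
  (j < m)%nat -> norm m (fun i => x i + t * basis j i - x i) = Rabs t.
Proof.
  intros Hj. unfold norm. rewrite <- sqrt_Rsqr_abs. f_equal. unfold rho, dot, Rsqr.
  assert (E : forall n, sumR n (fun i => (x i + t * basis j i - x i) * (x i + t * basis j i - x i))
            = if Nat.ltb j n then t * t else 0).
  { intros n; induction n as [|n IH]; [reflexivity|]. cbn [sumR]. rewrite IH. unfold basis.
    destruct (Nat.ltb_spec j n), (Nat.eqb_spec n j), (Nat.ltb_spec j (S n)); try lia; ring. }
  rewrite E. destruct (Nat.ltb_spec j m); [reflexivity | lia].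
Qed.

Lemma inRm_shift (m : nat) (x : pt) (j : nat) (t : R) :
  (j < m)%nat -> inRm m x -> inRm m (fun i => x i + t * basis j i).
Proof.
  intros Hj Hx i Hi. unfold basis. rewrite Hx by assumption.
  destruct (Nat.eqb_spec i j); [lia | ring].
Qed.

Lemma shift0 (x : pt) (j : nat) : (fun i => x i + 0 * basis j i) = x.
Proof. extensionality i; ring. Qed.

(** * Continuity on R^m and open sets *)

Lemma cont_at_plus (m : nat) (f g : pt -> R) (x : pt) :
  cont_at m f x -> cont_at m g x -> cont_at m (fun y => f y + g y) x.
Proof.
  intros Hf Hg e He.
  destruct (Hf (e / 2)) as (d1 & Hd1 & H1); [lra|].
  destruct (Hg (e / 2)) as (d2 & Hd2 & H2); [lra|].
  exists (Rmin d1 d2); split; [apply Rmin_pos; assumption|].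
  intros y Hy Hn.
  assert (A := H1 y Hy ltac:(eapply Rlt_le_trans; [apply Hn | apply Rmin_l])).
  assert (B := H2 y Hy ltac:(eapply Rlt_le_trans; [apply Hn | apply Rmin_r])).
  replace (f y + g y - (f x + g x)) with ((f y - f x) + (g y - g x)) by ring.
  eapply Rle_lt_trans; [apply Rabs_triang|]. lra.
Qed.

Lemma cont_at_comp (m : nat) (F : R -> R) (f : pt -> R) (x : pt) :
  continuity_pt F (f x) -> cont_at m f x -> cont_at m (fun y => F (f y)) x.
Proof.
  intros HF Hf e He. destruct (HF e He) as (d & Hd & H).
  destruct (Hf d Hd) as (d' & Hd' & H'). exists d'; split; [assumption|].
  (* [continuity_pt] is a limit over points different from [f x], so [f y = f x] is treated
     apart. *)
  intros y Hy Hn. destruct (Req_dec (f x) (f y)) as [E|N].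
  - rewrite E, Rminus_diag, Rabs_R0; assumption.
  - apply (H (f y)). split; [split; [exact I | assumption]|]. apply H'; assumption.
Qed.

Lemma cont_at_const (m : nat) (a : R) (x : pt) : cont_at m (fun _ => a) x.
Proof. intros e He; exists 1; split; [lra|]; intros; rewrite Rminus_diag, Rabs_R0; lra. Qed.

Lemma cont_at_scal (m : nat) (a : R) (f : pt -> R) (x : pt) :
  cont_at m f x -> cont_at m (fun y => a * f y) x.
Proof.
  apply (cont_at_comp m (fun u => a * u)). apply derivable_continuous_pt. reg.
Qed.

(* Polarization: [f g] is a combination of squares. *)
Lemma cont_at_mult (m : nat) (f g : pt -> R) (x : pt) :
  cont_at m f x -> cont_at m g x -> cont_at m (fun y => f y * g y) x.
Proof.
  intros Hf Hg.
  assert (Sq : forall h, cont_at m h x -> cont_at m (fun y => h y * h y) x).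
  { intros h. apply (cont_at_comp m (fun u => u * u)). apply derivable_continuous_pt. reg. }
  replace (fun y => f y * g y)
    with (fun y => / 4 * ((f y + g y) * (f y + g y))
                   + (- / 4) * ((f y + (-1) * g y) * (f y + (-1) * g y)))
    by (extensionality y; field).
  apply cont_at_plus; apply cont_at_scal;
    [apply (Sq (fun y => f y + g y)) | apply (Sq (fun y => f y + (-1) * g y))];
    apply cont_at_plus; try apply cont_at_scal; assumption.
Qed.

Lemma cont_at_coord (m i : nat) (x : pt) : inRm m x -> cont_at m (fun y => y i) x.
Proof.
  intros Hx e He. exists e; split; [assumption|]. intros y Hy Hn.
  destruct (Nat.lt_ge_cases i m) as [L|L].
  - eapply Rle_lt_trans; [apply (abs_le_norm m (fun i => y i - x i) i L) | exact Hn].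
  - rewrite Hx, Hy, Rminus_diag, Rabs_R0; assumption.
Qed.

Lemma cont_at_sum (m n : nat) (f : nat -> pt -> R) (x : pt) :
  (forall i, (i < n)%nat -> cont_at m (f i) x) -> cont_at m (fun y => sumR n (fun i => f i y)) x.
Proof.
  induction n as [|n IH]; intros H; simpl; [apply cont_at_const|].
  apply cont_at_plus; [apply IH; intros i Hi|]; apply H; lia.
Qed.

Lemma cont_at_pos (m : nat) (f : pt -> R) (x : pt) :
  cont_at m f x -> 0 < f x ->
  exists d, 0 < d /\ forall y, inRm m y -> norm m (fun i => y i - x i) < d -> 0 < f y.
Proof.
  intros Hf Hx. destruct (Hf (f x) Hx) as (d & Hd & H). exists d; split; [assumption|].
  intros y Hy Hn. specialize (H y Hy Hn). apply Rabs_def2 in H; lra.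
Qed.

Definition open_in (m : nat) (U : pt -> Prop) : Prop :=
  forall x, inRm m x -> U x ->
    exists d, 0 < d /\ forall y, inRm m y -> norm m (fun i => y i - x i) < d -> U y.

(** Balls and the complement of V_G are both obtained as positivity sets, of r^2 - rho and of
    |G|^2. *)
Lemma open_in_pos (m : nat) (U : pt -> Prop) (f : pt -> R) :
  open_in m U -> (forall x, inRm m x -> U x -> cont_at m f x) ->
  open_in m (fun x => U x /\ 0 < f x).
Proof.
  intros HU Hf x Hx [Ux Px].
  destruct (HU x Hx Ux) as (d1 & Hd1 & H1).
  destruct (cont_at_pos m f x (Hf x Hx Ux) Px) as (d2 & Hd2 & H2).
  exists (Rmin d1 d2); split; [apply Rmin_pos; assumption|]. intros y Hy Hn. split.
  - apply H1; [assumption|]. eapply Rlt_le_trans; [apply Hn | apply Rmin_l].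
  - apply H2; [assumption|]. eapply Rlt_le_trans; [apply Hn | apply Rmin_r].
Qed.

(** * Partial derivatives and smooth functions *)

Lemma pd_unique (f : pt -> R) (x : pt) (j : nat) (l : R) : has_partial f x j l -> pd f x j = l.
Proof.
  intros H. unfold pd.
  assert (E : has_partial f x j (epsilon (inhabits 0) (fun l => has_partial f x j l)))
    by (apply epsilon_spec; exists l; assumption).
  unfold has_partial in *; eapply uniqueness_limite; eassumption.
Qed.

Lemma has_partial_ext (m : nat) (U : pt -> Prop) (f g : pt -> R) (x : pt) (j : nat) (l : R) :
  open_in m U -> (forall y, inRm m y -> U y -> f y = g y) ->
  inRm m x -> U x -> (j < m)%nat -> has_partial f x j l -> has_partial g x j l.
Proof.
  intros HU E Hx Ux Hj Hf e He. destruct (HU x Hx Ux) as (d & Hd & H).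
  destruct (Hf e He) as (d' & H').
  assert (Hm : 0 < Rmin d d') by (apply Rmin_pos; [assumption | apply cond_pos]).
  exists (mkposreal _ Hm). intros h Hh0 Hh. cbn [pos] in Hh.
  rewrite shift0. rewrite <- !E.
  - specialize (H' h Hh0). rewrite shift0 in H'. apply H'.
    eapply Rlt_le_trans; [apply Hh | apply Rmin_r].
  - assumption.
  - assumption.
  - apply inRm_shift; assumption.
  - apply H; [apply inRm_shift; assumption|]. rewrite norm_shift by assumption.
    rewrite Rplus_0_l. eapply Rlt_le_trans; [apply Hh | apply Rmin_l].
Qed.

Lemma cont_at_ext (m : nat) (U : pt -> Prop) (f g : pt -> R) (x : pt) :
  open_in m U -> (forall y, inRm m y -> U y -> f y = g y) ->
  inRm m x -> U x -> cont_at m f x -> cont_at m g x.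
Proof.
  intros HU E Hx Ux Hf e He. destruct (HU x Hx Ux) as (d & Hd & H).
  destruct (Hf e He) as (d' & Hd' & H').
  exists (Rmin d d'); split; [apply Rmin_pos; assumption|]. intros y Hy Hn.
  rewrite <- !E; try assumption.
  - apply H'; [assumption|]. eapply Rlt_le_trans; [apply Hn | apply Rmin_r].
  - apply H; [assumption|]. eapply Rlt_le_trans; [apply Hn | apply Rmin_l].
Qed.

(** [pd] is an epsilon choice, arbitrary where the partial derivative does not exist, so an explicit
    derivative is known to equal it only on U. Openness of U passes such an equality on to the next
    derivatives, which see only nearby points. *)
Lemma Ck_ext (m k : nat) (U : pt -> Prop) (f g : pt -> R) :
  open_in m U -> (forall y, inRm m y -> U y -> f y = g y) -> Ck m k U f -> Ck m k U g.
Proof.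
  intros HU. revert f g. induction k as [|k IH]; intros f g E; simpl.
  - intros Hf x Hx Ux. eapply cont_at_ext; eauto.
  - intros [Hp Hd]. split.
    + intros x Hx Ux j Hj. destruct (Hp x Hx Ux j Hj) as (l & Hl).
      exists l. eapply has_partial_ext; eauto.
    + intros j Hj. apply (IH (fun x => pd f x j)); [|apply Hd; assumption].
      intros y Hy Uy. destruct (Hp y Hy Uy j Hj) as (l & Hl).
      rewrite (pd_unique f y j l Hl). symmetry; apply pd_unique.
      eapply has_partial_ext; eauto.
Qed.

(** A coinduction principle: since C contains a derivative of each of its members, the induction on
    the order k needs no formula for higher derivatives. It serves for [smooth_alg] and for power
    series of varying radius. *)
Lemma smooth_coind (m : nat) (U : pt -> Prop) (C : (pt -> R) -> Prop) :
  open_in m U ->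
  (forall f x, C f -> inRm m x -> U x -> cont_at m f x) ->
  (forall f j, C f -> (j < m)%nat ->
     exists g, C g /\ forall x, inRm m x -> U x -> has_partial f x j (g x)) ->
  forall f, C f -> smooth_on m U f.
Proof.
  intros HU Hc Hd f Cf k. revert f Cf. induction k as [|k IH]; intros f Cf; simpl.
  - intros x; apply Hc; assumption.
  - split.
    + intros x Hx Ux j Hj. destruct (Hd f j Cf Hj) as (g & _ & Hg).
      exists (g x); apply Hg; assumption.
    + intros j Hj. destruct (Hd f j Cf Hj) as (g & Cg & Hg).
      apply (Ck_ext m k U g); [assumption | | apply IH; assumption].
      intros y Hy Uy. symmetry; apply pd_unique, Hg; assumption.
Qed.

Lemma smooth_cont (m : nat) (U : pt -> Prop) (f : pt -> R) (x : pt) :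
  smooth_on m U f -> inRm m x -> U x -> cont_at m f x.
Proof. intros H; exact (H 0%nat x). Qed.

Lemma smooth_has_partial (m : nat) (U : pt -> Prop) (f : pt -> R) (x : pt) (j : nat) :
  smooth_on m U f -> inRm m x -> U x -> (j < m)%nat -> has_partial f x j (pd f x j).
Proof.
  intros H Hx Ux Hj. destruct (proj1 (H 1%nat) x Hx Ux j Hj) as (l & Hl).
  rewrite (pd_unique _ _ _ _ Hl); assumption.
Qed.

Lemma smooth_pd (m : nat) (U : pt -> Prop) (f : pt -> R) (j : nat) :
  smooth_on m U f -> (j < m)%nat -> smooth_on m U (fun x => pd f x j).
Proof. intros H Hj k. exact (proj2 (H (S k)) j Hj). Qed.

Lemma smooth_mono (m : nat) (U V : pt -> Prop) (f : pt -> R) :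
  (forall x, V x -> U x) -> smooth_on m U f -> smooth_on m V f.
Proof.
  intros HV H k. specialize (H k). revert f H. induction k as [|k IH]; intros f; simpl.
  - intros H x Hx Vx; apply H; auto.
  - intros [Hp Hd]; split; [intros x Hx Vx; apply Hp; auto | intros j Hj; apply IH, Hd, Hj].
Qed.

Lemma has_partial_const (a : R) (x : pt) (j : nat) : has_partial (fun _ => a) x j 0.
Proof. apply derivable_pt_lim_const. Qed.

Lemma has_partial_coord (i : nat) (x : pt) (j : nat) : has_partial (fun y => y i) x j (basis j i).
Proof.
  intros e He. exists (mkposreal 1 Rlt_0_1). intros h Hh _.
  replace ((x i + (0 + h) * basis j i - (x i + 0 * basis j i)) / h - basis j i) with 0
    by (field; assumption).
  rewrite Rabs_R0; assumption.
Qed.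

Lemma has_partial_plus (f g : pt -> R) (x : pt) (j : nat) (a b : R) :
  has_partial f x j a -> has_partial g x j b -> has_partial (fun y => f y + g y) x j (a + b).
Proof. apply derivable_pt_lim_plus. Qed.

Lemma has_partial_mult (f g : pt -> R) (x : pt) (j : nat) (a b : R) :
  has_partial f x j a -> has_partial g x j b ->
  has_partial (fun y => f y * g y) x j (a * g x + f x * b).
Proof.
  intros Hf Hg. assert (H := derivable_pt_lim_mult _ _ _ _ _ Hf Hg).
  cbv beta in H. rewrite shift0 in H. exact H.
Qed.

Lemma has_partial_comp (F : R -> R) (f : pt -> R) (x : pt) (j : nat) (a b : R) :
  derivable_pt_lim F (f x) b -> has_partial f x j a -> has_partial (fun y => F (f y)) x j (b * a).
Proof.
  intros HF Hf. apply (derivable_pt_lim_comp (fun t => f (fun i => x i + t * basis j i)) F).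
  - exact Hf.
  - rewrite shift0; exact HF.
Qed.

(** Expressions stable under partial derivatives: the derivative of each constructor is again built
    from the constructors, so [smooth_coind] gives all orders at once, without Leibniz or chain
    rules of order k. *)
Inductive smooth_alg (m : nat) (U : pt -> Prop) : (pt -> R) -> Prop :=
| sa_base f : smooth_on m U f -> smooth_alg m U f
| sa_const a : smooth_alg m U (fun _ => a)
| sa_coord i : smooth_alg m U (fun x => x i)
| sa_plus f g : smooth_alg m U f -> smooth_alg m U g -> smooth_alg m U (fun x => f x + g x)
| sa_mult f g : smooth_alg m U f -> smooth_alg m U g -> smooth_alg m U (fun x => f x * g x)
| sa_inv f : smooth_alg m U f -> (forall x, inRm m x -> U x -> f x <> 0) ->
    smooth_alg m U (fun x => / f x)
| sa_sqrt f : smooth_alg m U f -> (forall x, inRm m x -> U x -> 0 < f x) ->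
    smooth_alg m U (fun x => sqrt (f x)).

Lemma derivable_pt_lim_Rinv (u : R) : u <> 0 -> derivable_pt_lim Rinv u (- (/ u * / u)).
Proof.
  intros Hu.
  assert (H := derivable_pt_lim_div (fct_cte 1) id u 0 1 (derivable_pt_lim_const 1 u)
                 (derivable_pt_lim_id u) Hu).
  replace (- (/ u * / u)) with ((0 * id u - 1 * fct_cte 1 u) / Rsqr (id u))
    by (unfold Rsqr, id, fct_cte; field; assumption).
  replace Rinv with (div_fct (fct_cte 1) id); [exact H|].
  extensionality t. apply Rmult_1_l.
Qed.

Lemma smooth_alg_cont (m : nat) (U : pt -> Prop) (f : pt -> R) (x : pt) :
  smooth_alg m U f -> inRm m x -> U x -> cont_at m f x.
Proof.
  intros Hf Hx Ux. induction Hf.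
  - eapply smooth_cont; eassumption.
  - apply cont_at_const.
  - apply cont_at_coord; assumption.
  - apply cont_at_plus; assumption.
  - apply cont_at_mult; assumption.
  - apply (cont_at_comp m Rinv); [|assumption]. apply derivable_continuous_pt.
    eexists; apply derivable_pt_lim_Rinv; auto.
  - apply (cont_at_comp m sqrt); [|assumption]. apply continuity_pt_sqrt. apply Rlt_le; auto.
Qed.

Lemma smooth_alg_partial (m : nat) (U : pt -> Prop) (f : pt -> R) (j : nat) :
  smooth_alg m U f -> (j < m)%nat ->
  exists g, smooth_alg m U g /\ forall x, inRm m x -> U x -> has_partial f x j (g x).
Proof.
  intros Hf Hj.
  induction Hf as [f H|a|i|f g Hf IHf Hg IHg|f g Hf IHf Hg IHg|f Hf IHf H|f Hf IHf H];
    try destruct IHf as (f' & Af & Pf); try destruct IHg as (g' & Ag & Pg).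
  - exists (fun x => pd f x j); split; [apply sa_base, smooth_pd; assumption|].
    intros x Hx Ux; eapply smooth_has_partial; eassumption.
  - exists (fun _ => 0); split; [apply sa_const | intros; apply has_partial_const].
  - exists (fun _ => basis j i); split; [apply sa_const | intros; apply has_partial_coord].
  - exists (fun x => f' x + g' x); split; [apply sa_plus; assumption|].
    intros; apply has_partial_plus; auto.
  - exists (fun x => f' x * g x + f x * g' x); split; [apply sa_plus; apply sa_mult; assumption|].
    intros; apply has_partial_mult; auto.
  - exists (fun x => (-1 * (/ f x * / f x)) * f' x); split.
    + apply sa_mult; [|assumption]. apply sa_mult; [apply sa_const|].
      apply sa_mult; apply sa_inv; assumption.
    + intros x Hx Ux. apply (has_partial_comp Rinv); [|auto].
      replace (-1 * (/ f x * / f x)) with (- (/ f x * / f x)) by ring.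
      apply derivable_pt_lim_Rinv; auto.
  - exists (fun x => (/ (2 * sqrt (f x))) * f' x); split.
    + apply sa_mult; [|assumption]. apply sa_inv.
      * apply sa_mult; [apply sa_const | apply sa_sqrt; assumption].
      * intros x Hx Ux. assert (0 < sqrt (f x)) by (apply sqrt_lt_R0; auto). lra.
    + intros x Hx Ux. apply (has_partial_comp sqrt); [|auto]. apply derivable_pt_lim_sqrt; auto.
Qed.

Lemma smooth_alg_smooth (m : nat) (U : pt -> Prop) (f : pt -> R) :
  open_in m U -> smooth_alg m U f -> smooth_on m U f.
Proof.
  intros HU. apply (smooth_coind m U (smooth_alg m U)).
  - assumption.
  - intros; eapply smooth_alg_cont; eassumption.
  - intros; eapply smooth_alg_partial; eassumption.
Qed.

(** * Real analytic functions are smooth *)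

(* For [|u|, |v| <= s' < s] the growth of the monomial [u^n] and of its derivatives is absorbed by
   the passage from [s'^n] to [s^n], with constants independent of [n]. *)
Lemma pow_le_larger (u s' s : R) (n : nat) :
  Rabs u <= s' -> s' < s -> Rabs (u ^ n) <= s ^ n.
Proof.
  intros Hu Hs. rewrite <- RPow_abs. apply pow_incr. split; [apply Rabs_pos | lra].
Qed.

Lemma pow_lipschitz (u v s' s : R) (n : nat) :
  Rabs u <= s' -> Rabs v <= s' -> s' < s ->
  Rabs (u ^ n - v ^ n) <= Rabs (u - v) * (s ^ n / (s - s')).
Proof.
  intros Hu Hv Hs. assert (H0 := Rabs_pos u). assert (D := Rabs_pos (u - v)).
  induction n as [|n IH].
  - simpl. rewrite Rminus_diag, Rabs_R0. apply Rmult_le_pos; [assumption|].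
    apply Rlt_le, Rdiv_lt_0_compat; lra.
  - simpl. replace (u * u ^ n - v * v ^ n) with (u * (u ^ n - v ^ n) + (u - v) * v ^ n) by ring.
    eapply Rle_trans; [apply Rabs_triang|]. rewrite !Rabs_mult.
    assert (P := pow_le_larger v s' s n Hv Hs).
    replace (Rabs (u - v) * (s * s ^ n / (s - s')))
      with (s' * (Rabs (u - v) * (s ^ n / (s - s'))) + Rabs (u - v) * s ^ n) by (field; lra).
    apply Rplus_le_compat; [apply Rmult_le_compat; auto using Rabs_pos|].
    apply Rmult_le_compat_l; assumption.
Qed.

Lemma pow_deriv_le (s' s : R) (n : nat) :
  0 <= s' -> s' < s -> INR n * s' ^ pred n <= s ^ n / (s - s').
Proof.
  intros H0 Hs. induction n as [|n IH].
  - simpl. rewrite Rmult_0_l. apply Rlt_le, Rdiv_lt_0_compat; lra.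
  - rewrite S_INR. cbn [pred].
    assert (E : INR n * s' ^ n = s' * (INR n * s' ^ pred n)) by (destruct n; simpl; ring).
    assert (P := pow_le_larger s' s' s n ltac:(rewrite Rabs_pos_eq; lra) Hs).
    rewrite Rabs_pos_eq in P by (apply pow_le; assumption).
    replace (s ^ S n / (s - s')) with (s' * (s ^ n / (s - s')) + s ^ n) by (simpl; field; lra).
    assert (s' * (INR n * s' ^ pred n) <= s' * (s ^ n / (s - s')))
      by (apply Rmult_le_compat_l; assumption).
    lra.
Qed.

Lemma pow_taylor (u t s' s : R) (n : nat) :
  Rabs u <= s' -> Rabs (u + t) <= s' -> s' < s ->
  Rabs ((u + t) ^ n - u ^ n - t * (INR n * u ^ pred n)) <= t ^ 2 * (s ^ n / (s - s') ^ 2).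
Proof.
  intros Hu Hv Hs. assert (H0 := Rabs_pos u).
  assert (T : 0 <= t ^ 2) by apply pow2_ge_0.
  induction n as [|n IH].
  - simpl. rewrite Rmult_0_l, Rmult_0_r, Rminus_0_r, Rminus_diag, Rabs_R0.
    apply Rmult_le_pos; [apply T|]. apply Rlt_le, Rdiv_lt_0_compat; nra.
  - rewrite S_INR. cbn [pred].
    replace ((u + t) ^ S n - u ^ S n - t * ((INR n + 1) * u ^ n))
      with ((u + t) * ((u + t) ^ n - u ^ n - t * (INR n * u ^ pred n))
            + t ^ 2 * (INR n * u ^ pred n)) by (destruct n; simpl; ring).
    eapply Rle_trans; [apply Rabs_triang|]. rewrite !Rabs_mult.
    rewrite (Rabs_pos_eq (t ^ 2)), (Rabs_pos_eq (INR n)) by (auto using pos_INR).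
    assert (P := pow_deriv_le s' s n ltac:(lra) Hs).
    assert (Q : INR n * Rabs (u ^ pred n) <= INR n * s' ^ pred n).
    { apply Rmult_le_compat_l; [apply pos_INR|]. rewrite <- RPow_abs.
      apply pow_incr; split; [apply Rabs_pos | assumption]. }
    replace (t ^ 2 * (s ^ S n / (s - s') ^ 2))
      with (s' * (t ^ 2 * (s ^ n / (s - s') ^ 2)) + t ^ 2 * (s ^ n / (s - s')))
      by (simpl; field; lra).
    apply Rplus_le_compat; [apply Rmult_le_compat; auto using Rabs_pos|].
    apply Rmult_le_compat_l; lra.
Qed.

(** * Estimates for monomials and polynomials *)

Definition deg (a : list nat) : nat := fold_right plus 0%nat a.

Lemma monom_bound (a : list nat) (x : pt) (k : nat) (s' s : R) :
  (forall i, Rabs (x i) <= s') -> s' < s -> Rabs (monom a x k) <= s ^ deg a.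
Proof.
  intros Hx Hs. revert k. induction a as [|a0 a IH]; intros k; simpl.
  - rewrite Rabs_R1; lra.
  - rewrite Rabs_mult, pow_add.
    apply Rmult_le_compat; eauto using Rabs_pos, pow_le_larger.
Qed.

Lemma pow_nonneg_of_abs (u s' s : R) (n : nat) : Rabs u <= s' -> s' < s -> 0 <= s ^ n.
Proof. intros Hu Hs. assert (H := Rabs_pos u). apply pow_le; lra. Qed.

(** Changing one coordinate at a time gives one [pow_lipschitz] error per variable, hence the factor
    [length a]. It is m for every monomial in m variables, so it does not grow with the degree. *)
Lemma monom_lipschitz (a : list nat) (x y : pt) (k : nat) (s' s d : R) :
  (forall i, Rabs (x i) <= s') -> (forall i, Rabs (y i) <= s') -> s' < s ->
  (forall i, Rabs (x i - y i) <= d) ->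
  Rabs (monom a x k - monom a y k) <= INR (length a) * d * (s ^ deg a / (s - s')).
Proof.
  intros Hx Hy Hs Hd. assert (d0 : 0 <= d) by (eapply Rle_trans; [apply Rabs_pos | apply (Hd 0%nat)]).
  revert k. induction a as [|a0 a IH]; intros k.
  - simpl. rewrite Rminus_diag, Rabs_R0, !Rmult_0_l; lra.
  - cbn [monom length deg fold_right]. fold (deg a). rewrite S_INR, pow_add.
    replace (x k ^ a0 * monom a x (S k) - y k ^ a0 * monom a y (S k))
      with ((x k ^ a0 - y k ^ a0) * monom a x (S k)
            + y k ^ a0 * (monom a x (S k) - monom a y (S k))) by ring.
    eapply Rle_trans; [apply Rabs_triang|]. rewrite !Rabs_mult.
    assert (P : Rabs (x k ^ a0 - y k ^ a0) <= d * (s ^ a0 / (s - s'))).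
    { eapply Rle_trans; [apply (pow_lipschitz _ _ s' s); auto|].
      apply Rmult_le_compat_r; [|apply Hd]. apply Rmult_le_pos; [|apply Rlt_le, Rinv_0_lt_compat; lra].
      eapply pow_nonneg_of_abs; [apply (Hx k) | assumption]. }
    replace ((INR (length a) + 1) * d * (s ^ a0 * s ^ deg a / (s - s')))
      with (d * (s ^ a0 / (s - s')) * s ^ deg a
            + s ^ a0 * (INR (length a) * d * (s ^ deg a / (s - s')))) by (field; lra).
    apply Rplus_le_compat; apply Rmult_le_compat;
      eauto using Rabs_pos, monom_bound, pow_le_larger.
Qed.

(* [d/dx_j x^a], as a coefficient and an exponent. *)
Fixpoint dmonom (a : list nat) (j : nat) : R * list nat :=
  match a with
  | nil => (0, nil)
  | a0 :: a' => match j with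
                | O => (INR a0, pred a0 :: a')
                | S j' => (fst (dmonom a' j'), a0 :: snd (dmonom a' j'))
                end
  end.

Lemma dmonom_length (a : list nat) (j : nat) : length (snd (dmonom a j)) = length a.
Proof. revert j; induction a as [|a0 a IH]; intros [|j]; simpl; auto. Qed.

(** A Cauchy estimate: the exponent brought down by differentiation is paid for by shrinking the
    radius from s to s', with a factor independent of a. *)
Lemma dmonom_bound (a : list nat) (j : nat) (s' s : R) :
  0 <= s' -> s' < s ->
  Rabs (fst (dmonom a j)) * s' ^ deg (snd (dmonom a j)) <= s ^ deg a / (s - s').
Proof.
  intros H0 Hs.
  assert (Hp : forall n, s' ^ n <= s ^ n) by (intros; apply pow_incr; lra).
  assert (Hq : forall n, 0 <= s' ^ n) by (intros; apply pow_le; lra).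
  revert j; induction a as [|a0 a IH]; intros j; simpl.
  - rewrite Rabs_R0, Rmult_0_l. apply Rlt_le, Rdiv_lt_0_compat; lra.
  - destruct j as [|j]; simpl.
    + rewrite Rabs_pos_eq by apply pos_INR. fold (deg a). rewrite !pow_add, <- Rmult_assoc.
      replace (s ^ a0 * s ^ deg a / (s - s')) with (s ^ a0 / (s - s') * s ^ deg a) by (field; lra).
      apply Rmult_le_compat; auto using pow_deriv_le.
      apply Rmult_le_pos; auto using pos_INR.
    + fold (deg a) (deg (snd (dmonom a j))). rewrite !pow_add.
      replace (s ^ a0 * s ^ deg a / (s - s')) with (s ^ a0 * (s ^ deg a / (s - s'))) by (field; lra).
      replace (Rabs (fst (dmonom a j)) * (s' ^ a0 * s' ^ deg (snd (dmonom a j))))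
        with (s' ^ a0 * (Rabs (fst (dmonom a j)) * s' ^ deg (snd (dmonom a j)))) by ring.
      apply Rmult_le_compat; auto. apply Rmult_le_pos; auto using Rabs_pos.
Qed.

Lemma monom_ext (a : list nat) (x y : pt) (k : nat) :
  (forall i, (k <= i)%nat -> x i = y i) -> monom a x k = monom a y k.
Proof.
  revert k; induction a as [|a0 a IH]; intros k H; simpl; [reflexivity|].
  rewrite (H k), (IH (S k)); auto with arith.
Qed.

(** The list a starts at coordinate k, so its j-th exponent belongs to coordinate j + k. Only that
    factor changes: [pow_taylor] applies to it, and the other factors are bounded by their powers of
    s. *)
Lemma monom_taylor (a : list nat) (x : pt) (j k : nat) (t s' s : R) :
  (forall i, Rabs (x i) <= s') -> (forall i, Rabs (x i + t * basis (j + k) i) <= s') -> s' < s ->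
  Rabs (monom a (fun i => x i + t * basis (j + k) i) k - monom a x k
        - t * (fst (dmonom a j) * monom (snd (dmonom a j)) x k))
  <= t ^ 2 * (s ^ deg a / (s - s') ^ 2).
Proof.
  intros Hx Hy Hs. assert (H0 := Rabs_pos (x 0%nat)).
  assert (Hs0 : s' >= 0) by (specialize (Hx 0%nat); lra).
  assert (T : 0 <= t ^ 2) by apply pow2_ge_0.
  assert (S2 : 0 < (s - s') ^ 2) by (apply pow_lt; lra).
  revert j k Hy; induction a as [|a0 a IH]; intros j k Hy.
  - simpl. replace (1 - 1 - t * (0 * 1)) with 0 by ring. rewrite Rabs_R0.
    apply Rmult_le_pos; [apply T|]. apply Rlt_le, Rdiv_lt_0_compat; simpl in S2; lra.
  - destruct j as [|j]; cbn [monom dmonom fst snd deg fold_right]; fold (deg a); rewrite pow_add.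
    + rewrite (monom_ext a _ x (S k)).
      2:{ intros i Hi. unfold basis. destruct (Nat.eqb_spec i (0 + k)); [lia | ring]. }
      specialize (Hy k). cbn [plus] in *. unfold basis at 1. unfold basis in Hy.
      rewrite Nat.eqb_refl in *. rewrite Rmult_1_r in *.
      replace ((x k + t) ^ a0 * monom a x (S k) - x k ^ a0 * monom a x (S k)
               - t * (INR a0 * (x k ^ pred a0 * monom a x (S k))))
        with (((x k + t) ^ a0 - x k ^ a0 - t * (INR a0 * x k ^ pred a0)) * monom a x (S k)) by ring.
      rewrite Rabs_mult.
      replace (t ^ 2 * (s ^ a0 * s ^ deg a / (s - s') ^ 2))
        with (t ^ 2 * (s ^ a0 / (s - s') ^ 2) * s ^ deg a) by (field; lra).
      apply Rmult_le_compat; eauto using Rabs_pos, pow_taylor, monom_bound.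
    + replace (x k + t * basis (S j + k) k) with (x k).
      2:{ unfold basis. destruct (Nat.eqb_spec k (S j + k)); [lia | ring]. }
      replace (S j + k)%nat with (j + S k)%nat in * by lia.
      replace (x k ^ a0 * monom a (fun i => x i + t * basis (j + S k) i) (S k)
               - x k ^ a0 * monom a x (S k)
               - t * (fst (dmonom a j) * (x k ^ a0 * monom (snd (dmonom a j)) x (S k))))
        with (x k ^ a0 * (monom a (fun i => x i + t * basis (j + S k) i) (S k) - monom a x (S k)
               - t * (fst (dmonom a j) * monom (snd (dmonom a j)) x (S k)))) by ring.
      rewrite Rabs_mult.
      replace (t ^ 2 * (s ^ a0 * s ^ deg a / (s - s') ^ 2))
        with (s ^ a0 * (t ^ 2 * (s ^ deg a / (s - s') ^ 2))) by (field; lra).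
      apply Rmult_le_compat; eauto using Rabs_pos, pow_le_larger.
Qed.

(* Polynomials as lists of terms; [pmaj s Q] bounds [Q] on the polydisc of radius [s]. *)
Definition peval (Q : list (R * list nat)) (x : pt) : R :=
  fold_right Rplus 0 (map (fun q => fst q * monom (snd q) x 0) Q).
Definition pmaj (s : R) (Q : list (R * list nat)) : R :=
  fold_right Rplus 0 (map (fun q => Rabs (fst q) * s ^ deg (snd q)) Q).
Definition dpoly (j : nat) (Q : list (R * list nat)) : list (R * list nat) :=
  map (fun q => (fst q * fst (dmonom (snd q) j), snd (dmonom (snd q) j))) Q.

Lemma pmaj_ge0 (s : R) (Q : list (R * list nat)) : 0 <= s -> 0 <= pmaj s Q.
Proof.
  intros Hs; induction Q as [|q Q IH]; unfold pmaj in *; simpl; [lra|].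
  apply Rplus_le_le_0_compat; [|assumption].
  apply Rmult_le_pos; [apply Rabs_pos | apply pow_le; assumption].
Qed.

Lemma peval_bound (Q : list (R * list nat)) (x : pt) (s' s : R) :
  (forall i, Rabs (x i) <= s') -> s' < s -> Rabs (peval Q x) <= pmaj s Q.
Proof.
  intros Hx Hs. unfold peval, pmaj. induction Q as [|q Q IH]; simpl; [rewrite Rabs_R0; lra|].
  eapply Rle_trans; [apply Rabs_triang|]. apply Rplus_le_compat; [|assumption].
  rewrite Rabs_mult. apply Rmult_le_compat_l; eauto using Rabs_pos, monom_bound.
Qed.

Lemma peval_lipschitz (m : nat) (Q : list (R * list nat)) (x y : pt) (s' s d : R) :
  Forall (fun q => length (snd q) = m) Q ->
  (forall i, Rabs (x i) <= s') -> (forall i, Rabs (y i) <= s') -> s' < s ->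
  (forall i, Rabs (x i - y i) <= d) ->
  Rabs (peval Q x - peval Q y) <= INR m * d / (s - s') * pmaj s Q.
Proof.
  intros HQ Hx Hy Hs Hd. unfold peval, pmaj. induction HQ as [|[c a] Q Ha HQ IH]; simpl.
  - rewrite Rminus_diag, Rabs_R0; lra.
  - simpl in Ha. rewrite Rmult_plus_distr_l.
    match goal with |- Rabs (?A + ?B - (?C + ?D)) <= _ =>
      replace (A + B - (C + D)) with ((A - C) + (B - D)) by ring end.
    eapply Rle_trans; [apply Rabs_triang|]. apply Rplus_le_compat; [|exact IH].
    rewrite <- Rmult_minus_distr_l, Rabs_mult.
    replace (INR m * d / (s - s') * (Rabs c * s ^ deg a))
      with (Rabs c * (INR (length a) * d * (s ^ deg a / (s - s')))) by (rewrite Ha; field; lra).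
    apply Rmult_le_compat_l; [apply Rabs_pos | apply monom_lipschitz; assumption].
Qed.

Lemma dpoly_length (m j : nat) (Q : list (R * list nat)) :
  Forall (fun q => length (snd q) = m) Q -> Forall (fun q => length (snd q) = m) (dpoly j Q).
Proof. induction 1; simpl; constructor; auto. simpl. rewrite dmonom_length; assumption. Qed.

Lemma pmaj_dpoly (j : nat) (Q : list (R * list nat)) (s' s : R) :
  0 <= s' -> s' < s -> pmaj s' (dpoly j Q) <= / (s - s') * pmaj s Q.
Proof.
  intros H0 Hs. unfold pmaj. induction Q as [|[c a] Q IH]; simpl; [lra|].
  rewrite Rmult_plus_distr_l. apply Rplus_le_compat; [|exact IH].
  rewrite Rabs_mult, Rmult_assoc.
  replace (/ (s - s') * (Rabs c * s ^ deg a)) with (Rabs c * (s ^ deg a / (s - s')))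
    by (field; lra).
  apply Rmult_le_compat_l; [apply Rabs_pos | apply dmonom_bound; assumption].
Qed.

Lemma peval_taylor (Q : list (R * list nat)) (x : pt) (j : nat) (t s' s : R) :
  (forall i, Rabs (x i) <= s') -> (forall i, Rabs (x i + t * basis j i) <= s') -> s' < s ->
  Rabs (peval Q (fun i => x i + t * basis j i) - peval Q x - t * peval (dpoly j Q) x)
  <= t ^ 2 / (s - s') ^ 2 * pmaj s Q.
Proof.
  intros Hx Hy Hs. unfold peval, pmaj. induction Q as [|[c a] Q IH]; simpl.
  - rewrite Rmult_0_r, !Rminus_0_r, Rabs_R0; lra.
  - rewrite !Rmult_plus_distr_l.
    match goal with |- Rabs (?A + ?B - (?C + ?D) - (?t * ?E + ?t * ?F)) <= _ =>
      replace (A + B - (C + D) - (t * E + t * F)) with ((A - C - t * E) + (B - D - t * F)) by ring end.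
    eapply Rle_trans; [apply Rabs_triang|]. apply Rplus_le_compat; [|exact IH].
    assert (M := monom_taylor a x j 0 t s' s Hx). rewrite Nat.add_0_r in M.
    specialize (M Hy Hs).
    match goal with |- Rabs (?c * ?A - ?c * ?B - ?t * (?c * ?D * ?E)) <= _ =>
      replace (c * A - c * B - t * (c * D * E)) with (c * (A - B - t * (D * E))) by ring end.
    rewrite Rabs_mult.
    replace (t * (t * 1) / ((s - s') * ((s - s') * 1)) * (Rabs c * s ^ deg a))
      with (Rabs c * (t ^ 2 * (s ^ deg a / (s - s') ^ 2))) by (field; lra).
    apply Rmult_le_compat_l; [apply Rabs_pos | exact M].
Qed.

(** * Convergent power series and their derivatives *)

Module PowerSeries.
Import Coquelicot.Coquelicot.

Lemma is_series_bound (a b : nat -> R) (la lb : R) :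
  is_series a la -> is_series b lb -> (forall n, Rabs (a n) <= b n) -> Rabs la <= lb.
Proof.
  intros Ha Hb Hab. rewrite <- (is_series_unique a la Ha), <- (is_series_unique b lb Hb).
  assert (Eb : ex_series b) by (exists lb; assumption).
  eapply Rle_trans; [apply Series_Rabs|].
  - apply (@ex_series_le R_AbsRing R_CompleteNormedModule _ b); [|assumption]. intros n.
    change (norm (Rabs (a n))) with (Rabs (Rabs (a n))). rewrite Rabs_Rabsolu; apply Hab.
  - apply Series_le; [|assumption]. intros n; split; [apply Rabs_pos | apply Hab].
Qed.

(** The polynomial [Q d] need not have degree d, so [dpoly] can be applied term by term without
    reindexing. The length condition keeps the Lipschitz constants uniform in d. *)
Definition power_series (m : nat) (s : R) (f : pt -> R) : Prop :=
  exists Q : nat -> list (R * list nat),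
    (forall d, List.Forall (fun q => length (snd q) = m) (Q d)) /\
    ex_series (fun d => pmaj s (Q d)) /\
    forall x, inRm m x -> (forall i, Rabs (x i) <= s) -> is_series (fun d => peval (Q d) x) (f x).

Lemma power_series_lipschitz (m : nat) (s' s : R) (f : pt -> R) :
  s' < s -> power_series m s f ->
  exists L, 0 <= L /\ forall x y d, inRm m x -> inRm m y ->
    (forall i, Rabs (x i) <= s') -> (forall i, Rabs (y i) <= s') ->
    (forall i, Rabs (x i - y i) <= d) -> Rabs (f x - f y) <= L * d.
Proof.
  intros Hs (Q & HQ & (M & HM) & Hf).
  (* The absolute value gives a nonnegative constant without examining the sign of M. *)
  exists (Rabs (INR m / (s - s') * M)); split; [apply Rabs_pos|].
  intros x y d Hx Hy Bx By Bd.
  assert (d0 : 0 <= d) by (eapply Rle_trans; [apply Rabs_pos | apply (Bd 0%nat)]).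
  apply Rle_trans with (INR m * d / (s - s') * M).
  - apply (is_series_bound (fun n => peval (Q n) x - peval (Q n) y)
             (fun n => INR m * d / (s - s') * pmaj s (Q n))).
    + apply (is_series_minus (fun d => peval (Q d) x) (fun d => peval (Q d) y));
        apply Hf; try assumption; intros i; eapply Rle_trans; eauto using Rlt_le.
    + exact (is_series_scal_l (INR m * d / (s - s')) _ _ HM).
    + intros n. apply peval_lipschitz; auto.
  - replace (INR m * d / (s - s') * M) with (INR m / (s - s') * M * d) by (field; lra).
    apply Rmult_le_compat_r; [assumption | apply Rle_abs].
Qed.

(** The quadratic remainders of the terms are summed against the majorant; the resulting constant C,
    uniform in x and t, replaces an exchange of limit and series. *)
Lemma power_series_partial (m j : nat) (s' s : R) (f : pt -> R) :
  (j < m)%nat -> 0 <= s' -> s' < s -> power_series m s f ->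
  exists g, power_series m s' g /\ exists C, 0 <= C /\ forall x t, inRm m x ->
    (forall i, Rabs (x i) <= s') -> (forall i, Rabs (x i + t * basis j i) <= s') ->
    Rabs (f (fun i => x i + t * basis j i) - f x - t * g x) <= C * t ^ 2.
Proof.
  intros Hj H0 Hs (Q & HQ & (M & HM) & Hf).
  set (g := fun x => Series (fun d => peval (dpoly j (Q d)) x)).
  (* [peval_bound] needs a radius strictly above s', and [pmaj_dpoly] one strictly below s. *)
  set (r := (s' + s) / 2).
  assert (Hr : s' < r < s) by (unfold r; lra).
  assert (Em : forall r, 0 <= r < s -> ex_series (fun d => pmaj r (dpoly j (Q d)))).
  { intros r0 Hr0. apply (@ex_series_le R_AbsRing R_CompleteNormedModule _ (fun d => / (s - r0) * pmaj s (Q d))).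
    - intros d. change (norm (pmaj r0 (dpoly j (Q d)))) with (Rabs (pmaj r0 (dpoly j (Q d)))).
      rewrite Rabs_pos_eq by (apply pmaj_ge0; lra). apply pmaj_dpoly; lra.
    - exists (/ (s - r0) * M). exact (is_series_scal_l (/ (s - r0)) _ _ HM). }
  assert (Hg : forall x, (forall i, Rabs (x i) <= s') ->
            is_series (fun d => peval (dpoly j (Q d)) x) (g x)).
  { intros x Bx. apply Series_correct.
    apply (@ex_series_le R_AbsRing R_CompleteNormedModule _ (fun d => pmaj r (dpoly j (Q d)))); [|apply Em; lra].
    intros d. apply (peval_bound _ x s' r); [assumption | lra]. }
  exists g. split.
  - exists (fun d => dpoly j (Q d)). split; [|split].
    + intros d; apply dpoly_length, HQ.
    + apply Em; lra.
    + intros x _; apply Hg.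
  - exists (Rabs (/ (s - s') ^ 2 * M)); split; [apply Rabs_pos|].
    intros x t Hx Bx By.
    apply Rle_trans with (t ^ 2 / (s - s') ^ 2 * M).
    + apply (is_series_bound
               (fun n => peval (Q n) (fun i => x i + t * basis j i) - peval (Q n) x
                         - t * peval (dpoly j (Q n)) x)
               (fun n => t ^ 2 / (s - s') ^ 2 * pmaj s (Q n))).
      * apply (is_series_minus
          (fun d => peval (Q d) (fun i => x i + t * basis j i) - peval (Q d) x)
          (fun d => t * peval (dpoly j (Q d)) x)).
        -- apply (is_series_minus (fun d => peval (Q d) (fun i => x i + t * basis j i))
                    (fun d => peval (Q d) x)); apply Hf;
             try (apply inRm_shift); try assumption;
             intros i; eapply Rle_trans; eauto using Rlt_le.
        -- apply (is_series_scal_l t _ _ (Hg x Bx)).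
      * exact (is_series_scal_l (t ^ 2 / (s - s') ^ 2) _ _ HM).
      * intros n. apply peval_taylor; auto.
    + replace (t ^ 2 / (s - s') ^ 2 * M) with (/ (s - s') ^ 2 * M * t ^ 2) by (field; lra).
      apply Rmult_le_compat_r; [apply pow2_ge_0 | apply Rle_abs].
Qed.
End PowerSeries.

Lemma polydisc_open (m : nat) (s : R) :
  open_in m (fun x => forall i, (i < m)%nat -> Rabs (x i) < s).
Proof.
  intros x _ Hx.
  (* Finitely many strict bounds leave a common margin s - s'; for m = 0 any s' below s will do. *)
  assert (H : exists s', s' < s /\ forall i, (i < m)%nat -> Rabs (x i) <= s').
  { induction m as [|m IH]; [exists (s - 1); split; [lra | lia]|].
    destruct IH as (s' & Hs & H); [intros; apply Hx; lia|].
    assert (Hm := Hx m ltac:(lia)).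
    exists (Rmax s' (Rabs (x m))); split; [apply Rmax_lub_lt; assumption|].
    intros i Hi. destruct (Nat.eq_dec i m) as [->|]; [apply Rmax_r|].
    eapply Rle_trans; [apply H; lia | apply Rmax_l]. }
  destruct H as (s' & Hs & H). exists (s - s'); split; [lra|].
  intros y _ Hy i Hi. assert (A := abs_le_norm m (fun i => y i - x i) i Hi).
  specialize (H i Hi). replace (y i) with ((y i - x i) + x i) by ring.
  eapply Rle_lt_trans; [apply Rabs_triang|]. simpl in *. lra.
Qed.

Lemma inRm_abs_le (m : nat) (x : pt) (s s' : R) :
  0 <= s' -> s <= s' -> inRm m x -> (forall i, (i < m)%nat -> Rabs (x i) < s) ->
  forall i, Rabs (x i) <= s'.
Proof.
  intros H0 Hs Hx B i. destruct (Nat.lt_ge_cases i m) as [L|L].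
  - specialize (B i L); lra.
  - rewrite Hx, Rabs_R0; assumption.
Qed.

(** Each differentiation costs some radius. The class given to [smooth_coind] therefore lets s vary
    above the fixed s0, and a derivative gets the midpoint (s0 + s) / 2. *)
Lemma power_series_smooth (m : nat) (s0 s : R) (f : pt -> R) :
  0 < s0 < s -> PowerSeries.power_series m s f ->
  smooth_on m (fun x => forall i, (i < m)%nat -> Rabs (x i) < s0) f.
Proof.
  intros [Hs0 Hs] Hf. set (U := fun x : pt => forall i, (i < m)%nat -> Rabs (x i) < s0).
  apply (smooth_coind m U (fun f => exists s, s0 < s /\ PowerSeries.power_series m s f)).
  - apply polydisc_open.
  - clear f s Hs Hf. intros f x (s & Hs & Hf) Hx Ux e He.
    destruct (PowerSeries.power_series_lipschitz m s0 s f Hs Hf) as (L & L0 & HL).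
    destruct (polydisc_open m s0 x Hx Ux) as (d & Hd & Hop).
    (* L may be 0, hence the denominator L + 1. *)
    exists (Rmin d (e / (L + 1))).
    assert (0 < e / (L + 1)) by (apply Rdiv_lt_0_compat; lra).
    split; [apply Rmin_pos; assumption|]. intros y Hy Hn.
    assert (Uy : U y).
    { intros i; apply Hop; [assumption|]. eapply Rlt_le_trans; [apply Hn | apply Rmin_l]. }
    set (N := norm m (fun i => y i - x i)) in *.
    assert (N0 : 0 <= N) by apply norm_ge0.
    apply Rle_lt_trans with (L * N).
    + apply HL; try assumption; try (apply (inRm_abs_le m _ s0); try assumption; lra).
      intros i. destruct (Nat.lt_ge_cases i m) as [Hi|Hi].
      * apply (abs_le_norm m (fun i => y i - x i) i Hi).
      * rewrite Hx, Hy, Rminus_diag, Rabs_R0 by assumption; assumption.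
    + assert (N < e / (L + 1)) by (eapply Rlt_le_trans; [apply Hn | apply Rmin_r]).
      apply Rle_lt_trans with ((L + 1) * N); [nra|].
      replace e with ((L + 1) * (e / (L + 1))) at 1 by (field; lra).
      apply Rmult_lt_compat_l; lra.
  - clear f s Hs Hf. intros f j (s & Hs & Hf) Hj.
    destruct (PowerSeries.power_series_partial m j ((s0 + s) / 2) s f Hj) as (g & Hg & C & C0 & HC);
      [lra | lra | assumption |].
    exists g; split; [exists ((s0 + s) / 2); split; [lra | assumption]|].
    intros x Hx Ux e He.
    (* The first bound keeps the shifted point in the polydisc of radius (s0 + s) / 2, the second
       makes C |h| < e. *)
    assert (Hd : 0 < Rmin ((s - s0) / 2) (e / (C + 1)))
      by (apply Rmin_pos; [lra | apply Rdiv_lt_0_compat; lra]).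
    exists (mkposreal _ Hd). intros h Hh0 Hh. cbn [pos] in Hh.
    rewrite shift0, Rplus_0_l.
    assert (Hh1 : Rabs h < (s - s0) / 2) by (eapply Rlt_le_trans; [apply Hh | apply Rmin_l]).
    assert (Hh2 : Rabs h < e / (C + 1)) by (eapply Rlt_le_trans; [apply Hh | apply Rmin_r]).
    assert (Bx : forall i, Rabs (x i) <= s0) by (apply (inRm_abs_le m _ s0); try assumption; lra).
    assert (T := HC x h Hx ltac:(intros i; specialize (Bx i); lra)).
    assert (By : forall i, Rabs (x i + h * basis j i) <= (s0 + s) / 2).
    { intros i. specialize (Bx i). eapply Rle_trans; [apply Rabs_triang|]. unfold basis.
      destruct (Nat.eqb i j); [rewrite Rmult_1_r | rewrite Rmult_0_r, Rabs_R0]; lra. }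
    specialize (T By). assert (Ph : 0 < Rabs h) by (apply Rabs_pos_lt; assumption).
    set (D := f (fun i => x i + h * basis j i) - f x) in *.
    replace (D / h - g x) with ((D - h * g x) / h) by (field; assumption).
    unfold Rdiv. rewrite Rabs_mult, Rabs_inv.
    apply Rmult_lt_reg_r with (Rabs h); [assumption|].
    rewrite Rmult_assoc, Rinv_l, Rmult_1_r by lra.
    eapply Rle_lt_trans; [apply T|]. rewrite <- pow2_abs.
    assert ((C + 1) * Rabs h < e).
    { replace e with ((C + 1) * (e / (C + 1))) by (field; lra). apply Rmult_lt_compat_l; lra. }
    nra.
  - exists s; split; assumption.
Qed.

Lemma mons_length (m d : nat) : Forall (fun a => length a = m) (mons m d).
Proof.
  apply Forall_forall. revert d. induction m as [|m IH]; intros d a; simpl.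
  - destruct d; simpl; [intros [<-|[]]; reflexivity | intros []].
  - intros H. apply in_app_or in H. destruct H as [H|H].
    + apply in_map_iff in H. destruct H as (b & <- & Hb). simpl. rewrite (IH _ _ Hb); reflexivity.
    + apply in_flat_map in H. destruct H as (k & _ & H).
      apply in_map_iff in H. destruct H as (b & <- & Hb). simpl. rewrite (IH _ _ Hb); reflexivity.
Qed.

Lemma monom_const (a : list nat) (x : pt) (k : nat) (s : R) :
  (forall i, (k <= i < k + length a)%nat -> x i = s) -> monom a x k = s ^ deg a.
Proof.
  revert k; induction a as [|a0 a IH]; intros k H; simpl; [reflexivity|].
  simpl in H. rewrite pow_add, (H k), (IH (S k)); [reflexivity | | lia].
  intros i Hi; apply H; lia.
Qed.

(* The series is evaluated at the corner [(s, .., s)] of the polydisc: there, absolute convergence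
   is summability of the majorants. *)
Lemma analytic_power_series (m : nat) (f : pt -> R) :
  analytic_at0 m f -> exists s, 0 < s /\ PowerSeries.power_series m s f.
Proof.
  (* With this s the closed polydisc, corner included, lies in the ball: m s^2 < ((m + 1) s)^2 =
     r^2. *)
  intros (r & Hr & c & H). set (s := r / (INR m + 1)).
  assert (Pm := pos_INR m).
  assert (Hs : 0 < s) by (apply Rdiv_lt_0_compat; lra).
  assert (Es : r = s * (INR m + 1)) by (unfold s; field; lra).
  assert (Hn : forall x, (forall i, Rabs (x i) <= s) -> norm m x < r).
  { intros x Bx. apply norm_lt_rho; [assumption|].
    apply Rle_lt_trans with (INR m * (s * s)); [|rewrite Es; nra].
    unfold rho, dot. rewrite <- sumR_const. apply sumR_le. intros i _.
    specialize (Bx i). assert (A := Rabs_pos (x i)).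
    replace (x i * x i) with (Rabs (x i) * Rabs (x i)) by (rewrite <- Rabs_mult; apply Rabs_pos_eq; nra).
    nra. }
  exists s; split; [assumption|].
  exists (fun d => map (fun a => (c a, a)) (mons m d)). split; [|split].
  - intros d. apply Forall_map. simpl. apply mons_length.
  - set (x := fun i => if Nat.ltb i m then s else 0).
    destruct (H x) as ((M & HM) & _).
    { intros i Hi. unfold x. destruct (Nat.ltb_spec i m); [lia | reflexivity]. }
    { apply Hn. intros i. unfold x. destruct (Nat.ltb i m).
      - rewrite Rabs_pos_eq; lra.
      - rewrite Rabs_R0; lra. }
    exists M. apply Coquelicot.Series.is_series_Reals in HM.
    eapply Coquelicot.Series.is_series_ext; [|exact HM].
    intros d. unfold hom_abs, pmaj. rewrite map_map. simpl. f_equal.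
    apply map_ext_in. intros a Ha.
    assert (La := proj1 (Forall_forall _ _) (mons_length m d) a Ha).
    rewrite Rabs_mult. f_equal. rewrite (monom_const a x 0 s).
    + apply Rabs_pos_eq, pow_le; lra.
    + intros i Hi. unfold x. destruct (Nat.ltb_spec i m); [reflexivity | simpl in La; lia].
  - intros x Hx Bx. destruct (H x Hx (Hn x Bx)) as (_ & Hf).
    apply Coquelicot.Series.is_series_Reals in Hf.
    eapply Coquelicot.Series.is_series_ext; [|exact Hf].
    intros d. unfold hom_part, peval. rewrite map_map. reflexivity.
Qed.

Lemma analytic_smooth (m : nat) (f : pt -> R) :
  analytic_at0 m f -> exists r, 0 < r /\ smooth_on m (fun x => norm m x < r) f.
Proof.
  intros H. destruct (analytic_power_series m f H) as (s & Hs & Hf).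
  exists (s / 2); split; [lra|].
  eapply smooth_mono; [|apply (power_series_smooth m (s / 2) s); [lra | assumption]].
  intros x Hx i Hi. eapply Rle_lt_trans; [apply abs_le_norm | apply Hx]; assumption.
Qed.

(** * Linear independence and Gram-Schmidt *)

Definition independent (m n : nat) (v : nat -> pt) : Prop :=
  forall c, (forall k, (k < m)%nat -> lincomb n c v k = 0) -> forall i, (i < n)%nat -> c i = 0.

(* Covers both the smooth functions on an open set and, for a pointwise statement, all functions. *)
Record function_field (U : pt -> Prop) (S : (pt -> R) -> Prop) : Prop := {
  ff_const : forall a, S (fun _ => a);
  ff_plus : forall f g, S f -> S g -> S (fun x => f x + g x);
  ff_mult : forall f g, S f -> S g -> S (fun x => f x * g x);
  ff_inv : forall f, S f -> (forall x, U x -> f x <> 0) -> S (fun x => / f x) }.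

Lemma ff_sum (U : pt -> Prop) (S : (pt -> R) -> Prop) (n : nat) (f : nat -> pt -> R) :
  function_field U S -> (forall i, (i < n)%nat -> S (f i)) -> S (fun x => sumR n (fun i => f i x)).
Proof.
  intros HS. induction n as [|n IH]; intros H; simpl; [apply (ff_const _ _ HS)|].
  apply (ff_plus _ _ HS); [apply IH; intros i Hi|]; apply H; lia.
Qed.

Lemma ff_dot (U : pt -> Prop) (S : (pt -> R) -> Prop) (m : nat) (u v : pt -> pt) :
  function_field U S -> (forall k, (k < m)%nat -> S (fun x => u x k)) ->
  (forall k, (k < m)%nat -> S (fun x => v x k)) -> S (fun x => dot m (u x) (v x)).
Proof.
  intros HS Hu Hv. apply (ff_sum U S m (fun k x => u x k * v x k) HS).
  intros; apply (ff_mult _ _ HS); auto.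
Qed.

Lemma ff_lincomb (U : pt -> Prop) (S : (pt -> R) -> Prop) (n k : nat)
  (c : nat -> pt -> R) (g : nat -> pt -> pt) :
  function_field U S -> (forall i, (i < n)%nat -> S (c i)) ->
  (forall i, (i < n)%nat -> S (fun x => g i x k)) ->
  S (fun x => lincomb n (fun i => c i x) (fun i => g i x) k).
Proof.
  intros HS Hc Hg. apply (ff_sum U S n (fun i x => c i x * g i x k) HS).
  intros; apply (ff_mult _ _ HS); auto.
Qed.

(* Gram-Schmidt: [h], the component of [g n] orthogonal to [g 0, .., g (n-1)], does not vanish by
   independence and corrects the last scalar product. *)
Lemma dual_solve (U : pt -> Prop) (S : (pt -> R) -> Prop) (m n : nat) (g : nat -> pt -> pt) :
  function_field U S ->
  (forall i k, (i < n)%nat -> (k < m)%nat -> S (fun x => g i x k)) ->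
  (forall x, U x -> independent m n (fun i => g i x)) ->
  forall b : nat -> pt -> R, (forall i, (i < n)%nat -> S (b i)) ->
  exists c : nat -> pt -> R, (forall i, (i < n)%nat -> S (c i)) /\
    forall x, U x -> forall k, (k < n)%nat ->
      dot m (lincomb n (fun i => c i x) (fun i => g i x)) (g k x) = b k x.
Proof.
  intros HS. induction n as [|n IH]; intros Hg Hi b Hb.
  { exists b; split; intros; lia. }
  assert (Hi' : forall x, U x -> independent m n (fun i => g i x)).
  { intros x Ux c Hc i Hin.
    assert (E : forall k, (k < m)%nat ->
              lincomb (Datatypes.S n) (fun i => if Nat.eqb i n then 0 else c i)
                (fun i => g i x) k = 0).
    { intros k Hk. transitivity (lincomb n c (fun i => g i x) k); [|apply Hc; assumption].
      unfold lincomb. simpl.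
      rewrite Nat.eqb_refl; cbv iota. rewrite Rmult_0_l, Rplus_0_r.
      apply sumR_ext; intros l Hl. destruct (Nat.eqb_spec l n); [lia | reflexivity]. }
    specialize (Hi x Ux _ E i ltac:(lia)). cbv beta in Hi.
    destruct (Nat.eqb_spec i n); [lia | exact Hi]. }
  specialize (IH ltac:(intros; apply Hg; lia) Hi').
  (* The coefficients c' are those of the projection of g n to the span of its predecessors. *)
  destruct (IH (fun k x => dot m (g n x) (g k x))) as (c' & Sc' & Hc').
  { intros i Hin. apply (ff_dot U S m); try assumption; intros; apply Hg; lia. }
  destruct (IH b ltac:(intros; apply Hb; lia)) as (c0 & Sc0 & Hc0).
  set (h := fun x k => 1 * g n x k + (-1) * lincomb n (fun i => c' i x) (fun i => g i x) k).
  assert (Sh : forall k, (k < m)%nat -> S (fun x => h x k)).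
  { intros k Hk. apply (ff_plus _ _ HS); apply (ff_mult _ _ HS); try apply (ff_const _ _ HS); auto.
    apply ff_lincomb with U; auto. }
  assert (Hh : forall x, U x -> forall k, (k < n)%nat -> dot m (h x) (g k x) = 0).
  { intros x Ux k Hk. unfold h. rewrite dot_comb_l, Hc' by assumption. ring. }
  (* h differs from g n by a vector of that span, to which h is orthogonal. *)
  assert (Hhh : forall x, U x -> dot m (h x) (g n x) = dot m (h x) (h x)).
  { intros x Ux.
    transitivity (dot m (g n x) (h x)); [apply dot_sym|]. symmetry. unfold h at 1.
    rewrite dot_comb_l, dot_lincomb_l, sumR_zero; [ring|].
    intros i Hin. rewrite dot_sym, Hh by assumption. ring. }
  (* Otherwise h = 0, a linear relation with coefficient 1 on g n. *)
  assert (Hnz : forall x, U x -> dot m (h x) (g n x) <> 0).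
  { intros x Ux E. rewrite Hhh in E by assumption.
    assert (Z : forall k, (k < m)%nat ->
              lincomb (Datatypes.S n) (fun i => if Nat.eqb i n then 1 else - c' i x)
                (fun i => g i x) k = 0).
    { intros k Hk. transitivity (h x k); [|apply (dot_self_eq0 m (h x) E k Hk)].
      unfold h, lincomb. simpl. rewrite Nat.eqb_refl. cbv iota.
      rewrite (sumR_ext n _ (fun i => (-1) * (c' i x * g i x k))); [rewrite sumR_scal; ring|].
      intros l Hl. destruct (Nat.eqb_spec l n); [lia | ring]. }
    specialize (Hi x Ux _ Z n ltac:(lia)). cbv beta in Hi. rewrite Nat.eqb_refl in Hi. lra. }
  (* Adding t h to the solution c0 leaves the first n scalar products unchanged; t is the quotient
     that corrects the last one. *)
  set (t := fun x => (b n x + (-1) * dot m (lincomb n (fun i => c0 i x) (fun i => g i x)) (g n x))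
                     * / dot m (h x) (g n x)).
  exists (fun i => if Nat.eqb i n then t else fun x => c0 i x + (-1) * (t x * c' i x)).
  assert (St : S t).
  { apply (ff_mult _ _ HS).
    - apply (ff_plus _ _ HS); [apply Hb; lia|].
      apply (ff_mult _ _ HS); [apply (ff_const _ _ HS)|].
      apply (ff_dot U S m (fun x => lincomb n (fun i => c0 i x) (fun i => g i x))); auto.
      intros k Hk. apply ff_lincomb with U; auto.
    - apply (ff_inv _ _ HS); [|exact Hnz]. apply (ff_dot U S m); auto. }
  split.
  - intros i Hin. destruct (Nat.eqb_spec i n); [assumption|].
    apply (ff_plus _ _ HS); [apply Sc0; lia|].
    apply (ff_mult _ _ HS); [apply (ff_const _ _ HS)|].
    apply (ff_mult _ _ HS); [assumption | apply Sc'; lia].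
  - intros x Ux k Hk.
    rewrite (dot_ext_l m _ (fun k => 1 * lincomb n (fun i => c0 i x) (fun i => g i x) k + t x * h x k)).
    + rewrite dot_comb_l. destruct (Nat.eq_dec k n) as [->|Hkn].
      * unfold t. field. apply Hnz; assumption.
      * rewrite Hh, Hc0 by (assumption || lia). ring.
    + intros l Hl. unfold h, lincomb. simpl. rewrite Nat.eqb_refl. cbv iota.
      rewrite (sumR_ext n _ (fun i => c0 i x * g i x l + (- t x) * (c' i x * g i x l))).
      * rewrite sumR_plus, sumR_scal. ring.
      * intros i Hin. destruct (Nat.eqb_spec i n); [lia | ring].
Qed.

(** * Gram determinants *)

Module GramDeterminant.
Import all_boot all_order all_algebra Rstruct.
Import Order.TTheory GRing.Theory Num.Theory.
Local Open Scope ring_scope.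

Lemma sumR_big (n : nat) (f : nat -> R) : sumR n f = \sum_(i < n) f i.
Proof. by elim: n => [|n IH]; rewrite ?big_ord0 // big_ord_recr /= IH. Qed.

(** Subtracting multiples of the first row u makes the other rows orthogonal to u and keeps the
    determinant. The Gram matrix is then block diagonal, with determinant |u|^2 times a smaller Gram
    determinant. If u = 0 the determinant is 0. *)
Lemma det_mulmx_tr_ge0 (n m : nat) (A : 'M[R]_(n, m)) : 0 <= \det (A *m A^T).
Proof.
elim: n A => [|n IH] A; first by rewrite det_mx00 ler01.
suff step (u : 'rV[R]_m) (B : 'M[R]_(n, m)) :
    0 <= \det (col_mx u B *m (col_mx u B)^T).
  have := step (usubmx (A : 'M_(1 + n, m))) (dsubmx (A : 'M_(1 + n, m))).
  by rewrite vsubmxK.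
clear A; set A := col_mx u B.
pose q := (u *m u^T) 0 0.
have Eq : u *m u^T = q%:M by rewrite [LHS]mx11_scalar.
have q_ge0 : 0 <= q.
  by rewrite /q mxE sumr_ge0 // => k _; rewrite [_^T _ _]mxE -expr2 sqr_ge0.
have [q0 | q0] := eqVneq q 0.
  have u0 : u = 0.
    apply/rowP => k; rewrite [RHS]mxE; apply/eqP; rewrite -sqrf_eq0.
    have /eqP := q0; rewrite /q mxE psumr_eq0; last first.
      by move=> i _; rewrite [_^T _ _]mxE -expr2 sqr_ge0.
    by move/allP/(_ k (mem_index_enum _)); rewrite [_^T _ _]mxE -expr2.
  by rewrite /A u0 tr_col_mx mul_col_row !mul0mx det_lblock det0 mul0r lexx.
(* The rows of [c *m u] are the orthogonal projections of the rows of B to the line of u. *)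
pose c := q^-1 *: (B *m u^T).
pose L : 'M[R]_(1 + n) := block_mx 1%:M 0 (- c) 1%:M.
have dL : \det L = 1 by rewrite det_lblock !det1 mulr1.
pose B' := B - c *m u.
have LA : L *m A = col_mx u B'.
  by rewrite mul_block_col !mul1mx mul0mx addr0 mulNmx addrC.
have orth : B' *m u^T = 0.
  rewrite mulmxBl -mulmxA Eq mul_mx_scalar /c scalerA mulfV // scale1r.
  by rewrite subrr.
have : \det ((L *m A) *m (L *m A)^T) = \det (A *m A^T).
  by rewrite trmx_mul mulmxA -[X in \det (X *m _)]mulmxA !det_mulmx det_tr dL mul1r mulr1.
move=> <-; rewrite LA tr_col_mx mul_col_row orth.
have -> : u *m B'^T = 0 by apply: trmx_inj; rewrite trmx_mul trmxK orth trmx0.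
by rewrite det_lblock Eq det_scalar1 mulr_ge0.
Qed.

Local Close Scope ring_scope.

(** Both sides expand along the first row; the conditional column index in [det] is [bump]. *)
Lemma det_matrix (n : nat) (A : nat -> nat -> R) :
  det n A = (\det (\matrix_(i < n, j < n) A i j))%R.
Proof.
elim: n A => [|n IH] A; first by rewrite det_mx00.
rewrite (expand_det_row _ ord0).
change (det n.+1 A) with (sumR n.+1 (fun c => (-1) ^ c * A 0%N c *
  det n (fun i j => A i.+1 (if Nat.ltb j c then j else j.+1)))).
rewrite sumR_big.
apply: eq_bigr => j _; rewrite mxE /cofactor IH /= add0n.
have -> : Rpow_def.pow (-1) j = ((-1) ^+ j)%R by rewrite RpowE.
rewrite [X in _ = X]mulrCA mulrA; congr (_ * \det _)%R.
apply/matrixP => a b; rewrite !mxE /=; congr (A _ _).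
rewrite /bump leqNgt.
by case: (Nat.ltb_spec b j) => [/ssrnat.ltP -> | /ssrnat.leP]; rewrite ?add0n // ltnNge => ->.
Qed.

Lemma gram_det_ge0 (m n : nat) (w : nat -> pt) :
  (0 <= det n (fun i c => dot m (w c) (w i))).
Proof.
apply/RleP; rewrite det_matrix.
have := det_mulmx_tr_ge0 _ _ (\matrix_(i < n, k < m) w i k)%R.
congr (_ <= \det _)%R; apply/matrixP => i c; rewrite !mxE /dot sumR_big.
by apply: eq_bigr => k _; rewrite !mxE mulrC.
Qed.

(** Cramer's rule: the factor E on the right of the Gram matrix is lower triangular with diagonal e
    0, 1, .., 1, so its determinant is e 0. *)
Lemma gram_det_replace (m n : nat) (w : nat -> pt) (v : pt) (e : nat -> R) :
  (forall k, (k < m)%coq_nat -> v k = lincomb n.+1 e w k) ->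
  det n.+1 (fun i c => match c with
                       | O => dot m v (w i) | S _ => dot m (w c) (w i) end)
  = (e 0%N * det n.+1 (fun i c => dot m (w c) (w i))).
Proof.
move=> Hv; rewrite !det_matrix.
pose E := (\matrix_(i < n.+1, c < n.+1) (if c == ord0 then e i else (i == c)%:R)%R : 'M[R]_n.+1)%R.
have dE : (\det E = e 0%N)%R.
  rewrite det_trig.
    rewrite big_ord_recl !mxE /= big1 ?mulr1 // => i _; rewrite mxE /= eqxx.
    by [].
  apply/is_trig_mxP => i c ltic; rewrite mxE.
  case: eqP => [c0 | _]; first by rewrite c0 in ltic.
  by case: eqP => // E'; rewrite E' ltnn in ltic.
rewrite -dE RmultE mulrC -det_mulmx; congr (\det _)%R.
apply/matrixP => i c; rewrite !mxE.
case: (unliftP ord0 c) => [c' ->|->] /=.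
  rewrite (bigD1 (lift ord0 c')) //= !mxE /= eqxx mulr1 big1 ?addr0 //.
  by move=> k /negbTE; rewrite !mxE /= => ->; rewrite mulr0.
rewrite /dot sumR_big.
under [LHS]eq_bigr => k _.
  rewrite Hv /lincomb ?sumR_big; last by apply/ssrnat.ltP.
  rewrite RmultE mulr_suml; over.
rewrite exchange_big; apply: eq_bigr => l _; rewrite !mxE /dot sumR_big /= mulr_suml.
by apply: eq_bigr => k _; rewrite -mulrA mulrC.
Qed.
End GramDeterminant.
(** * Geometry of G, rho and Psi_G *)

Lemma lincomb_basis (n i : nat) (v : nat -> pt) (k : nat) :
  (i < n)%nat -> lincomb n (basis i) v k = v i k.
Proof.
  intros Hi. unfold lincomb.
  assert (E : forall n, sumR n (fun l => basis i l * v l k) = if Nat.ltb i n then v i k else 0).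
  { clear. intros n; induction n as [|n IH]; [reflexivity|]. cbn [sumR]. rewrite IH. unfold basis.
    destruct (Nat.ltb_spec i n), (Nat.eqb_spec n i), (Nat.ltb_spec i (S n));
      try lia; subst; ring. }
  rewrite E. destruct (Nat.ltb_spec i n); [reflexivity | lia].
Qed.

Lemma not_dependent_independent (m n : nat) (v : nat -> pt) :
  ~ (exists c : nat -> R, (exists i, (i < n)%nat /\ c i <> 0) /\
       forall k, (k < m)%nat -> lincomb n c v k = 0) -> independent m n v.
Proof.
  intros H c Hc i Hi. apply NNPP; intros N. apply H. exists c; split; [exists i|]; auto.
Qed.

Lemma independent_solve (m n : nat) (v : nat -> pt) (b : nat -> R) :
  independent m n v ->
  exists c, forall k, (k < n)%nat -> dot m (lincomb n c v) (v k) = b k.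
Proof.
  intros Hv.
  (* Taking all functions as the function field and data constant in the base point turns
     [dual_solve] into a pointwise statement. *)
  destruct (dual_solve (fun _ => True) (fun _ => True) m n (fun i _ => v i))
    with (b := fun k (_ : pt) => b k) as (c & _ & Hc); auto.
  { constructor; auto. }
  exists (fun i => c i zero_pt). intros k Hk. apply (Hc zero_pt I k Hk).
Qed.

Lemma independent_dual (m n : nat) (v : nat -> pt) :
  independent m n v ->
  exists u : nat -> pt, forall i k, (k < n)%nat -> dot m (u i) (v k) = basis i k.
Proof.
  intros Hv.
  exists (fun i => lincomb n (epsilon (inhabits zero_pt) (fun c => forall k, (k < n)%nat ->
            dot m (lincomb n c v) (v k) = basis i k)) v).
  intros i. apply (epsilon_spec (inhabits zero_pt) (fun c => forall k, (k < n)%nat ->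
            dot m (lincomb n c v) (v k) = basis i k) (independent_solve m n v (basis i) Hv)).
Qed.

Lemma exists_max_abs (n : nat) (c : nat -> R) :
  (0 < n)%nat -> exists i, (i < n)%nat /\ forall k, (k < n)%nat -> Rabs (c k) <= Rabs (c i).
Proof.
  induction n as [|n IH]; intros Hn; [lia|].
  destruct n as [|n].
  { exists 0%nat; split; [lia|]. intros k Hk. replace k with 0%nat by lia. lra. }
  destruct IH as (i & Hi & H); [lia|].
  destruct (Rle_or_lt (Rabs (c (S n))) (Rabs (c i))) as [L|L].
  - exists i; split; [lia|]. intros k Hk. destruct (Nat.eq_dec k (S n)) as [->|]; [assumption|].
    apply H; lia.
  - exists (S n); split; [lia|]. intros k Hk. destruct (Nat.eq_dec k (S n)) as [->|]; [lra|].
    apply Rlt_le, Rle_lt_trans with (Rabs (c i)); [apply H; lia | assumption].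
Qed.

(** For a coefficient c l of largest absolute value, the l-th equation gives |c l| <= n / (n + 1) |c
    l|. *)
Lemma diagonally_dominant (n : nat) (A : nat -> nat -> R) (c : nat -> R) :
  (forall i k, (i < n)%nat -> (k < n)%nat ->
     Rabs (A i k - basis i k) < / (INR n + 1)) ->
  (forall i, (i < n)%nat -> sumR n (fun k => c k * A i k) = 0) ->
  forall i, (i < n)%nat -> c i = 0.
Proof.
  intros HA Hc i Hi.
  destruct (exists_max_abs n c ltac:(lia)) as (l & Hl & Max).
  assert (Hn : 0 < INR n) by (apply lt_0_INR; lia).
  assert (E : c l = - sumR n (fun k => c k * (A l k - basis l k))).
  { assert (B := lincomb_basis n l (fun k _ => c k) 0%nat Hl). unfold lincomb in B.
    assert (F : sumR n (fun k => c k * (A l k - basis l k))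
                = sumR n (fun k => c k * A l k) + (-1) * c l).
    { rewrite <- B, <- sumR_scal, <- sumR_plus. apply sumR_ext; intros k _. ring. }
    rewrite F, Hc by assumption. ring. }
  assert (L : Rabs (c l) <= INR n * (Rabs (c l) * / (INR n + 1))).
  { rewrite E at 1. rewrite Rabs_Ropp. eapply Rle_trans; [apply sumR_abs|].
    rewrite <- sumR_const. apply sumR_le; intros k Hk. rewrite Rabs_mult.
    apply Rmult_le_compat; auto using Rabs_pos, Rlt_le. }
  assert (Z : Rabs (c l) * (INR n + 1) <= INR n * Rabs (c l)).
  { replace (INR n * Rabs (c l)) with (INR n * (Rabs (c l) * / (INR n + 1)) * (INR n + 1))
      by (field; lra).
    apply Rmult_le_compat_r; lra. }
  specialize (Max i Hi). assert (P := Rabs_pos (c i)).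
  destruct (Req_dec (c i) 0) as [|N]; [assumption|]. apply Rabs_pos_lt in N. nra.
Qed.

(* The fixed dual family at [x] still pairs with [v y] to a diagonally dominant matrix. *)
Lemma independent_open (m n : nat) (v : nat -> pt -> pt) (x : pt) :
  (forall i k, (i < n)%nat -> (k < m)%nat -> cont_at m (fun y => v i y k) x) ->
  independent m n (fun i => v i x) ->
  exists d, 0 < d /\ forall y, inRm m y -> norm m (fun i => y i - x i) < d ->
    independent m n (fun i => v i y).
Proof.
  intros Hc Hv. destruct (independent_dual m n _ Hv) as (u & Hu).
  set (e := fun i k y => dot m (u i) (v k y) + (- basis i k)).
  (* One continuous function controls all entries: q < 1 / (n + 1)^2 keeps each of them within the
     tolerance of [diagonally_dominant]. *)
  set (q := fun y => sumR n (fun i => sumR n (fun k => e i k y * e i k y))).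
  assert (Pn := pos_INR n).
  assert (P0 : 0 < / (INR n + 1)) by (apply Rinv_0_lt_compat; lra).
  destruct (cont_at_pos m (fun y => / (INR n + 1) * / (INR n + 1) + (-1) * q y) x) as (d & Hd & H).
  - apply cont_at_plus; [apply cont_at_const|]. apply cont_at_scal.
    apply (cont_at_sum m n (fun i y => sumR n (fun k => e i k y * e i k y))). intros i Hi.
    apply (cont_at_sum m n (fun k y => e i k y * e i k y)). intros k Hk.
    assert (C : cont_at m (e i k) x).
    { apply cont_at_plus; [|apply cont_at_const].
      apply (cont_at_sum m m (fun l y => u i l * v k y l)). intros l Hl.
      apply cont_at_scal, Hc; assumption. }
    apply cont_at_mult; exact C.
  - assert (Q : q x = 0); [|rewrite Q; nra].
    apply sumR_zero; intros i Hi. apply sumR_zero; intros k Hk.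
    unfold e. rewrite Hu by assumption. ring.
  - exists d; split; [assumption|]. intros y Hy Hn c Hlc.
    specialize (H y Hy Hn). cbv beta in H.
    apply (diagonally_dominant n (fun i k => dot m (u i) (v k y))).
    + intros i k Hi Hk. change (Rabs (e i k y) < / (INR n + 1)).
      assert (Le : e i k y * e i k y <= q y).
      { eapply Rle_trans; [|apply (sumR_term_le n (fun i => sumR n (fun k => e i k y * e i k y)) i);
          [|assumption]].
        - apply (sumR_term_le n (fun k => e i k y * e i k y) k); [|assumption].
          intros; apply Rle_0_sqr.
        - intros; apply sumR_ge0; intros; apply Rle_0_sqr. }
      rewrite <- (Rabs_pos_eq (/ (INR n + 1))) by lra. apply Rsqr_lt_abs_0. unfold Rsqr. lra.
    + intros i Hi.
      transitivity (dot m (lincomb n c (fun i => v i y)) (u i)).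
      * rewrite dot_lincomb_l. apply sumR_ext; intros k Hk. rewrite dot_sym; reflexivity.
      * unfold dot. apply sumR_zero; intros k Hk. rewrite Hlc by assumption. ring.
Qed.

(** [sumR] peels off the last term, whereas the distinguished vector in [depset] and [wvec] has
    index 0. *)
Lemma lincomb_recl (n : nat) (c : nat -> R) (v : nat -> pt) (k : nat) :
  lincomb (S n) c v k = c 0%nat * v 0%nat k + lincomb n (fun i => c (S i)) (fun i => v (S i)) k.
Proof.
  unfold lincomb. induction n as [|n IH]; [simpl; ring|].
  cbn [sumR] in *. rewrite IH. ring.
Qed.

(** * Gradients of |G|^2 and Psi_G *)

Lemma pd_normG2 (m p : nat) (U : pt -> Prop) (G : nat -> pt -> R) (x : pt) (j : nat) :
  (forall i, (i < p)%nat -> smooth_on m U (G i)) -> inRm m x -> U x -> (j < m)%nat ->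
  has_partial (normG2 p G) x j (2 * sumR p (fun i => G i x * grad m (G i) x j)).
Proof.
  intros HG Hx Ux Hj. unfold normG2. induction p as [|p IH]; simpl.
  - rewrite Rmult_0_r. apply has_partial_const.
  - rewrite Rmult_plus_distr_l. apply has_partial_plus; [apply IH; auto|].
    assert (H := smooth_has_partial m U (G p) x j (HG p ltac:(lia)) Hx Ux Hj).
    assert (Eg : grad m (G p) x j = pd (G p) x j)
      by (unfold grad; destruct (Nat.ltb_spec j m); [reflexivity | lia]).
    rewrite Eg.
    replace (2 * (G p x * pd (G p) x j))
      with (pd (G p) x j * (G p x * 1) + G p x * (pd (G p) x j * 1 + G p x * 0)) by ring.
    apply has_partial_mult; [assumption|].
    apply has_partial_mult; [assumption | apply has_partial_const].
Qed.

Lemma grad_normG2 (m p : nat) (U : pt -> Prop) (G : nat -> pt -> R) (x : pt) (k : nat) :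
  (forall i, (i < p)%nat -> smooth_on m U (G i)) -> inRm m x -> U x -> (k < m)%nat ->
  grad m (normG2 p G) x k = lincomb p (fun i => 2 * G i x) (fun i => grad m (G i) x) k.
Proof.
  intros HG Hx Ux Hk. unfold grad at 1. destruct (Nat.ltb_spec k m); [|lia].
  rewrite (pd_unique _ _ _ _ (pd_normG2 m p U G x k HG Hx Ux Hk)).
  unfold lincomb. rewrite <- sumR_scal. apply sumR_ext; intros; ring.
Qed.

Lemma normG2_pos (p : nat) (G : nat -> pt -> R) (x : pt) : 0 < normG2 p G x <-> ~ VG p G x.
Proof.
  unfold normG2, VG. split.
  - intros H N. rewrite sumR_zero in H; [lra|]. intros i Hi; rewrite N by assumption; ring.
  - intros N. apply NNPP; intros H. apply N. intros i Hi.
    assert (L := sumR_term_le p (fun i => G i x ^ 2) i ltac:(intros; apply pow2_ge_0) Hi).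
    cbv beta in L. assert (Q := pow2_ge_0 (G i x)). nra.
Qed.

Lemma dot_grad_normG2 (m p : nat) (U : pt -> Prop) (G : nat -> pt -> R) (x v : pt) :
  (forall i, (i < p)%nat -> smooth_on m U (G i)) -> inRm m x -> U x ->
  dot m v (grad m (normG2 p G) x) = 2 * sumR p (fun i => G i x * dot m v (grad m (G i) x)).
Proof.
  intros HG Hx Ux.
  rewrite dot_sym, (dot_ext_l m _ _ v (fun k Hk => grad_normG2 m p U G x k HG Hx Ux Hk)).
  rewrite dot_lincomb_l, <- sumR_scal. apply sumR_ext; intros i _. rewrite dot_sym; ring.
Qed.

Lemma grad_Psi (m p : nat) (U : pt -> Prop) (G : nat -> pt -> R) (x : pt) (i k : nat) :
  (forall i, (i < p)%nat -> smooth_on m U (G i)) -> inRm m x -> U x -> ~ VG p G x ->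
  (i < p)%nat -> (k < m)%nat ->
  grad m (Psi p G i) x k
  = / sqrt (normG2 p G x) * grad m (G i) x k
    + (- (G i x / (2 * sqrt (normG2 p G x) * normG2 p G x))) * grad m (normG2 p G) x k.
Proof.
  intros HG Hx Ux Hn Hi Hk. apply normG2_pos in Hn.
  assert (Hs := sqrt_lt_R0 _ Hn). assert (Es := sqrt_sqrt _ (Rlt_le _ _ Hn)).
  unfold grad. destruct (Nat.ltb_spec k m); [|lia].
  assert (HN := pd_normG2 m p U G x k HG Hx Ux Hk).
  rewrite <- (pd_unique _ _ _ _ HN) in HN.
  assert (Hi' := smooth_has_partial m U (G i) x k (HG i Hi) Hx Ux Hk).
  apply pd_unique. unfold Psi, Rdiv.
  set (s := sqrt (normG2 p G x)) in *.
  assert (Hsq := has_partial_comp sqrt (normG2 p G) x k _ _ (derivable_pt_lim_sqrt _ Hn) HN).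
  fold s in Hsq.
  assert (Hinv := has_partial_comp Rinv (fun y => sqrt (normG2 p G y)) x k _ _
                    (derivable_pt_lim_Rinv s ltac:(lra)) Hsq).
  assert (HP := has_partial_mult _ _ _ _ _ _ Hi' Hinv). cbv beta in HP. fold s in HP.
  match goal with |- has_partial _ _ _ ?a => match type of HP with has_partial _ _ _ ?b =>
    replace a with b; [exact HP|] end end.
  rewrite <- Es. field. lra.
Qed.

(** The derivative of Psi_G along v is the component of DG(v) orthogonal to G, divided by |G|; it
    vanishes when DG(v) is a multiple of G. *)
Lemma dot_grad_Psi (m p : nat) (U : pt -> Prop) (G : nat -> pt -> R) (x v : pt) (i : nat) :
  (forall i, (i < p)%nat -> smooth_on m U (G i)) -> inRm m x -> U x -> ~ VG p G x -> (i < p)%nat ->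
  dot m (grad m (Psi p G i) x) v
  = / sqrt (normG2 p G x)
    * (dot m v (grad m (G i) x)
       - G i x / normG2 p G x * sumR p (fun l => G l x * dot m v (grad m (G l) x))).
Proof.
  intros HG Hx Ux Hn Hi.
  rewrite (dot_ext_l m _ _ v (fun k Hk => grad_Psi m p U G x i k HG Hx Ux Hn Hi Hk)).
  rewrite dot_comb_l, (dot_sym m (grad m (normG2 p G) x)).
  rewrite (dot_grad_normG2 m p U G x v HG Hx Ux), (dot_sym m (grad m (G i) x)).
  apply normG2_pos in Hn. assert (Hs := sqrt_lt_R0 _ Hn). field. lra.
Qed.

(** * The generators of W and the sign of a *)

Lemma sumR_kidx (n j : nat) (F : nat -> R) :
  (j <= n)%nat -> sumR (S n) F = F j + sumR n (fun l => F (kidx j (S l))).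
Proof.
  (* Position 0 belongs to grad |G|^2, so the indices other than j are listed from position 1 on;
     hence the shift to [S l]. *)
  assert (E : forall l, kidx j (S l) = if Nat.ltb l j then l else S l).
  { intros l. unfold kidx. rewrite Nat.sub_succ, Nat.sub_0_r. reflexivity. }
  intros Hj. destruct (Nat.eq_dec j n) as [->|Hn].
  - cbn [sumR]. rewrite Rplus_comm. f_equal. apply sumR_ext; intros l Hl. rewrite E.
    destruct (Nat.ltb_spec l n); [reflexivity | lia].
  - revert Hj Hn. induction n as [|n IH]; intros Hj Hn; [lia|].
    destruct (Nat.eq_dec j n) as [->|Hn'].
    + cbn [sumR]. rewrite (sumR_ext n (fun l => F (kidx n (S l))) F), E.
      * rewrite Nat.ltb_irrefl. ring.
      * intros l Hl. rewrite E. destruct (Nat.ltb_spec l n); [reflexivity | lia].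
    + cbn [sumR] in *. rewrite IH, E by lia.
      destruct (Nat.ltb_spec n j); [lia | ring].
Qed.

(** Summing c_l Omega_l / G_j over all l gives the combination of the grad G_l minus (grad G_j /
    G_j) times the sum of the c_l G_l, which is 0. The term l = j drops out because Omega_j = 0. *)
Lemma in_W_Omega (m p : nat) (G : nat -> pt -> R) (j : nat) (x : pt) (c : nat -> R) (k : nat) :
  (j < S p)%nat -> G j x <> 0 -> sumR (S p) (fun i => c i * G i x) = 0 ->
  lincomb (S p) c (fun i => grad m (G i) x) k
  = sumR p (fun l => c (kidx j (S l)) / G j x * Omega m G j (kidx j (S l)) x k).
Proof.
  intros Hj Hne Hc.
  assert (E := sumR_kidx p j (fun l => c l / G j x * Omega m G j l x k) ltac:(lia)).
  cbv beta in E. unfold Omega at 2 in E.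
  transitivity (sumR (S p) (fun l => c l / G j x * Omega m G j l x k)).
  - unfold lincomb, Omega. symmetry.
    rewrite (sumR_ext (S p) _ (fun l => c l * grad m (G l) x k
               + (- grad m (G j) x k / G j x) * (c l * G l x))) by (intros; field; assumption).
    rewrite sumR_plus, sumR_scal, Hc.
    rewrite Rmult_0_r, Rplus_0_r. reflexivity.
  - rewrite E. ring.
Qed.

Lemma a_pos_of_det (m p : nat) (G : nat -> pt -> R) (j : nat) (x : pt) (a : R) :
  (j < p)%nat -> G j x <> 0 -> a_prop m p G x a -> 0 < det p (Dmat m p G j x) -> 0 < a.
Proof.
  intros Hj Hne (c & Hc & Hv) HD. destruct p as [|p]; [lia|].
  assert (E := GramDeterminant.gram_det_replace m p (wvec m (S p) G j x) (grad m (rho m) x)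
     (fun l => match l with O => a | S l' => c (kidx j (S l')) / G j x end)).
  assert (P := GramDeterminant.gram_det_ge0 m (S p) (wvec m (S p) G j x)).
  unfold Dmat in HD. rewrite E in HD; [nra|].
  intros k Hk. specialize (Hv k Hk). rewrite (in_W_Omega m p G j x c k Hj Hne Hc) in Hv.
  transitivity (a * grad m (normG2 (S p) G) x k
     + sumR p (fun l => c (kidx j (S l)) / G j x * Omega m G j (kidx j (S l)) x k)); [lra|].
  rewrite lincomb_recl. reflexivity.
Qed.

(** * Smoothness, open sets and the points of M(G) *)

Lemma function_field_smooth (m : nat) (U : pt -> Prop) :
  open_in m U -> function_field (fun x => inRm m x /\ U x) (smooth_on m U).
Proof.
  intros HU. constructor; intros; apply smooth_alg_smooth; try assumption.
  - apply sa_const.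
  - apply sa_plus; apply sa_base; assumption.
  - apply sa_mult; apply sa_base; assumption.
  - apply sa_inv; [apply sa_base; assumption | auto].
Qed.

Lemma smooth_rho (m : nat) (U : pt -> Prop) : open_in m U -> smooth_on m U (rho m).
Proof.
  intros HU. apply (ff_dot _ _ m (fun x => x) (fun x => x) (function_field_smooth m U HU));
    intros; apply smooth_alg_smooth, sa_coord; assumption.
Qed.

Lemma smooth_grad (m k : nat) (U : pt -> Prop) (f : pt -> R) :
  (k < m)%nat -> smooth_on m U f -> smooth_on m U (fun x => grad m f x k).
Proof.
  intros Hk Hf. unfold grad. destruct (Nat.ltb_spec k m); [|lia]. apply smooth_pd; assumption.
Qed.

Lemma inRm_grad (m : nat) (f : pt -> R) (x : pt) : inRm m (grad m f x).
Proof. intros i Hi. unfold grad. destruct (Nat.ltb_spec i m); [lia | reflexivity]. Qed.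

Lemma inRm_lincomb (m n : nat) (c : nat -> R) (v : nat -> pt) :
  (forall i, inRm m (v i)) -> inRm m (lincomb n c v).
Proof. intros H k Hk. apply sumR_zero; intros i _. rewrite H by assumption; ring. Qed.

Lemma open_in_iff (m : nat) (U V : pt -> Prop) :
  (forall x, U x <-> V x) -> open_in m U -> open_in m V.
Proof.
  intros E HU x Hx Vx. destruct (HU x Hx (proj2 (E x) Vx)) as (d & Hd & H).
  exists d; split; [assumption|]. intros y Hy Hn. apply E, H; assumption.
Qed.

Lemma ball_open (m : nat) (r : R) : 0 < r -> open_in m (fun x => norm m x < r).
Proof.
  intros Hr. assert (T : open_in m (fun _ => True)) by (intros x _ _; exists 1; split; auto; lra).
  apply (open_in_iff m (fun x => True /\ 0 < r * r + (-1) * rho m x)).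
  - intros x. rewrite norm_lt_rho by assumption. split; [intros []; lra | split; [exact I | lra]].
  - apply open_in_pos; [exact T|]. intros x Hx _. apply cont_at_plus; [apply cont_at_const|].
    apply cont_at_scal. apply (smooth_cont m (fun _ => True)); auto using smooth_rho.
Qed.

Lemma punctured_open (m p : nat) (G : nat -> pt -> R) (U : pt -> Prop) :
  open_in m U -> (forall i, (i < p)%nat -> smooth_on m U (G i)) ->
  open_in m (fun x => U x /\ ~ VG p G x).
Proof.
  intros HU HG. apply (open_in_iff m (fun x => U x /\ 0 < normG2 p G x)).
  - intros x. rewrite normG2_pos. reflexivity.
  - apply open_in_pos; [assumption|]. intros x Hx Ux.
    apply (cont_at_sum m p (fun i y => G i y ^ 2)). intros i Hi.
    apply (cont_at_comp m (fun u => u ^ 2)).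
    + apply derivable_continuous_pt. apply derivable_pt_pow.
    + eapply smooth_cont; eauto.
Qed.

(** By [independent_open], linear dependence of continuous vector fields is a closed condition, so
    the closure in M(G) adds no point of U. *)
Lemma MG_depset (m p : nat) (G : nat -> pt -> R) (U : pt -> Prop) (x : pt) :
  open_in m U -> (forall i, (i < p)%nat -> smooth_on m U (G i)) ->
  inRm m x -> U x -> MG m p G x -> depset m p G x.
Proof.
  intros HU HG Hx Ux HM. apply NNPP; intros N.
  set (v := fun (i : nat) (y : pt) => match i with
              | O => grad m (rho m) y | S i' => grad m (G i') y end).
  destruct (independent_open m (S p) v x) as (d & Hd & H).
  - intros i k Hi Hk. apply (smooth_cont m U); try assumption.
    destruct i as [|i]; apply smooth_grad; auto using smooth_rho. apply HG; lia.
  - apply not_dependent_independent. intros (c & (i & Hi & Hc) & Hl).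
    apply N. exists c; split; [exists i; split; [lia | assumption]|].
    intros k Hk. apply Hl; assumption.
  - destruct (HM d Hd) as (y & Hy & Hn & c & (i & Hi & Hc) & Hl).
    apply Hc. apply (H y Hy Hn c); [assumption | lia].
Qed.

Lemma depset_span (m p : nat) (G : nat -> pt -> R) (x : pt) :
  depset m p G x -> ~ SingG m p G x ->
  exists d, forall k, (k < m)%nat ->
    grad m (rho m) x k = lincomb p d (fun i => grad m (G i) x) k.
Proof.
  intros (c & (i & Hi & Hci) & Hc) HS.
  destruct (Req_dec (c 0%nat) 0) as [E|N].
  (* A zero coefficient on grad rho would leave a relation among the grad G_i alone. *)
  - exfalso; apply HS. destruct i as [|i]; [contradiction|].
    exists (fun i => c (S i)). split; [exists i; split; [lia | assumption]|].
    intros k Hk. specialize (Hc k Hk). rewrite lincomb_recl, E, Rmult_0_l, Rplus_0_l in Hc. exact Hc.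
  - exists (fun i => - / c 0%nat * c (S i)). intros k Hk. specialize (Hc k Hk).
    rewrite lincomb_recl in Hc. unfold lincomb in *.
    rewrite (sumR_ext p _ (fun i => - / c 0%nat * (c (S i) * grad m (G i) x k)))
      by (intros; ring).
    rewrite sumR_scal.
    replace (sumR p (fun i => c (S i) * grad m (G i) x k))
      with (- (c 0%nat * grad m (rho m) x k)) by lra.
    field; assumption.
Qed.

Lemma a_prop_exists (m p : nat) (G : nat -> pt -> R) (U : pt -> Prop) (x : pt) :
  (forall i, (i < p)%nat -> smooth_on m U (G i)) -> inRm m x -> U x ->
  depset m p G x -> ~ VG p G x -> ~ SingG m p G x -> exists a, a_prop m p G x a.
Proof.
  intros HG Hx Ux Hdep HV HS. destruct (depset_span m p G x Hdep HS) as (d & Hd).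
  apply normG2_pos in HV.
  (* This value is forced: the coefficients c_i = d_i - 2 a G_i must satisfy sum c_i G_i = 0. *)
  set (a := sumR p (fun i => d i * G i x) / (2 * normG2 p G x)).
  exists a, (fun i => d i + (- 2 * a) * G i x). split.
  - rewrite (sumR_ext p _ (fun i => d i * G i x + (- 2 * a) * G i x ^ 2)) by (intros; ring).
    rewrite sumR_plus, sumR_scal. fold (normG2 p G x). unfold a. field. lra.
  - intros k Hk. rewrite Hd, (grad_normG2 m p U) by assumption. unfold lincomb.
    unfold Rminus. rewrite Ropp_mult_distr_l, <- sumR_scal, <- sumR_plus.
    apply sumR_ext; intros; ring.
Qed.

(** The dependence is assumed at x itself, which both uses can supply: one gets it from M(G), the
    other from the vanishing of r. The epsilon choice [acoef] has the defining property as soon as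
    some a has it. *)
Lemma acoef_pos (m p : nat) (G : nat -> pt -> R) (U : pt -> Prop) (x : pt) :
  (forall i, (i < p)%nat -> smooth_on m U (G i)) -> inRm m x -> U x ->
  depset m p G x -> ~ VG p G x -> ~ SingG m p G x ->
  (forall j, (j < p)%nat -> G j x <> 0 -> 0 < det p (Dmat m p G j x)) ->
  a_prop m p G x (acoef m p G x) /\ 0 < acoef m p G x.
Proof.
  intros HG Hx Ux Hdep HV HS HD.
  assert (Ha : a_prop m p G x (acoef m p G x))
    by (unfold acoef; apply epsilon_spec, (a_prop_exists m p G U); assumption).
  split; [assumption|]. apply not_all_ex_not in HV. destruct HV as (j & Hj).
  apply imply_to_and in Hj. destruct Hj as (Hj & Hne).
  apply (a_pos_of_det m p G j x); auto.
Qed.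

(** * The Milnor vector field and submersions *)

(* The coefficients [sqrt (b^2 + R^2) + b] and [sqrt (b^2 + R^2) - b] serve as mu and lam, with
   [b = <v, grad rho>] and [R = |r|^2 = <r, grad rho>]. *)
Lemma blend_pos (b R : R) :
  0 <= R -> (R = 0 -> 0 < b) ->
  0 < b * b + R * R /\ 0 < sqrt (b * b + R * R) + b /\
  0 < (sqrt (b * b + R * R) + b) * b + (sqrt (b * b + R * R) - b) * R.
Proof.
  intros HR Hb. assert (P : 0 < b * b + R * R).
  { destruct (Req_dec R 0) as [E|N]; [specialize (Hb E)|]; nra. }
  split; [assumption|].
  assert (HS := sqrt_lt_R0 _ P). assert (ES := sqrt_sqrt _ (Rlt_le _ _ P)).
  set (S := sqrt (b * b + R * R)) in *.
  destruct (Req_dec R 0) as [E|N].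
  - specialize (Hb E). subst R. split; nra.
  - assert (R0 : 0 < R) by lra.
    assert (A : 0 < S + b) by nra. assert (B : 0 < S - b) by nra.
    split; [assumption|]. destruct (Rle_or_lt 0 b) as [L|L]; [nra|].
    assert (C : R <= S) by nra.
    (* Here b < 0. As (S + b)(S - b) = R^2, multiplying by S - b leaves R (R b + (S - b)^2), where S
       - b exceeds both R and -b. *)
    apply Rmult_lt_reg_l with (S - b); [assumption|]. rewrite Rmult_0_r.
    replace ((S - b) * ((S + b) * b + (S - b) * R)) with (R * (R * b + (S - b) * (S - b)))
      by (replace (R * (R * b + (S - b) * (S - b)))
            with ((R * R) * b + R * ((S - b) * (S - b))) by ring;
          replace (R * R) with (S * S - b * b) by lra; ring).
    apply Rmult_lt_0_compat; nra.
Qed.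

Lemma milnor_vf_exists (m p : nat) (G : nat -> pt -> R) (eps : R) :
  0 < eps -> (forall i, (i < p)%nat -> smooth_on m (fun x => norm m x < eps) (G i)) ->
  (forall x, inRm m x -> norm m x < eps -> ~ VG p G x -> ~ SingG m p G x) ->
  (forall x, inRm m x -> norm m x < eps -> ~ VG p G x -> depset m p G x ->
     exists a, 0 < a /\ a_prop m p G x a) ->
  exists nu, milnor_vf m p G eps nu.
Proof.
  intros Heps HG0 HS Ha.
  set (U := fun x => norm m x < eps /\ ~ VG p G x).
  assert (HU : open_in m U) by (apply punctured_open; [apply ball_open|]; assumption).
  assert (HG : forall i, (i < p)%nat -> smooth_on m U (G i))
    by (intros i Hi; apply (smooth_mono m (fun x => norm m x < eps)); [intros x []|]; auto).
  assert (FF := function_field_smooth m U HU).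
  set (g := fun i => grad m (G i)). set (gr := grad m (rho m)).
  assert (Sgr : forall k, (k < m)%nat -> smooth_on m U (fun x => gr x k))
    by (intros; apply smooth_grad, smooth_rho; assumption).
  assert (Sg : forall i k, (i < p)%nat -> (k < m)%nat -> smooth_on m U (fun x => g i x k))
    by (intros; apply smooth_grad; auto).
  assert (Ind : forall x, inRm m x /\ U x -> independent m p (fun i => g i x))
    by (intros x (Hx & Hn & HV); apply not_dependent_independent, (HS x); assumption).
  destruct (dual_solve _ _ m p g FF Sg Ind G HG) as (c & Sc & Hc).
  destruct (dual_solve _ _ m p g FF Sg Ind (fun k x => dot m (gr x) (g k x))) as (d & Sd & Hd).
  { intros i Hi. apply (ff_dot _ _ m gr (g i) FF); auto. }
  set (v := fun x => lincomb p (fun i => c i x) (fun i => g i x)).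
  set (r := fun x k => 1 * gr x k + (-1) * lincomb p (fun i => d i x) (fun i => g i x) k).
  assert (Sv : forall k, (k < m)%nat -> smooth_on m U (fun x => v x k))
    by (intros k Hk; apply (ff_lincomb _ _ p k c g FF); auto).
  assert (Sr : forall k, (k < m)%nat -> smooth_on m U (fun x => r x k)).
  { intros k Hk. apply (ff_plus _ _ FF); apply (ff_mult _ _ FF); try apply (ff_const _ _ FF); auto.
    apply (ff_lincomb _ _ p k d g FF); auto. }
  set (b := fun x => dot m (v x) (gr x)). set (R := fun x => dot m (r x) (r x)).
  assert (Hr : forall x k, inRm m x -> U x -> (k < p)%nat -> dot m (r x) (g k x) = 0).
  { intros x k Hx Ux Hk. unfold r. rewrite dot_comb_l, Hd by auto. ring. }
  assert (Hrr : forall x, inRm m x -> U x -> dot m (r x) (gr x) = R x).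
  { intros x Hx Ux. transitivity (dot m (gr x) (r x)); [apply dot_sym|]. symmetry.
    unfold R. unfold r at 1. rewrite dot_comb_l, dot_lincomb_l, sumR_zero; [ring|].
    intros i Hi. rewrite dot_sym, Hr by assumption. ring. }
  assert (Hb : forall x, inRm m x -> U x -> R x = 0 -> 0 < b x).
  { intros x Hx Ux E. assert (Z := dot_self_eq0 m (r x) E). destruct Ux as (Hn & HV).
    destruct (Ha x Hx Hn HV) as (a & a0 & c' & Hc' & Hw).
    (* r = 0 is a linear relation with coefficient 1 on grad rho. *)
    - exists (fun i => match i with O => 1 | S i' => - d i' x end). split.
      + exists 0%nat; split; [lia | lra].
      + intros k Hk. rewrite <- (Z k Hk). rewrite lincomb_recl. unfold r. f_equal.
        unfold lincomb. rewrite <- sumR_scal. apply sumR_ext; intros; unfold g; ring.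
    (* Pair v with grad rho = a grad |G|^2 + w: the first term contributes 2 a |G|^2, and w
       contributes sum c'_i G_i = 0. *)
    - assert (Eb : b x = a * dot m (grad m (normG2 p G) x) (v x)
                       + 1 * dot m (lincomb p c' (fun i => g i x)) (v x)).
      { unfold b. rewrite dot_sym, <- dot_comb_l. apply dot_ext_l. intros k Hk.
        specialize (Hw k Hk). unfold gr, g. lra. }
      rewrite Eb, dot_lincomb_l, dot_sym.
      rewrite (dot_grad_normG2 m p U G x (v x) HG Hx (conj Hn HV)).
      assert (Hvg : forall i, (i < p)%nat -> dot m (v x) (g i x) = G i x)
        by (intros i Hi; apply Hc; [split; [|split]|]; assumption).
      assert (E1 : sumR p (fun i => G i x * dot m (v x) (grad m (G i) x)) = normG2 p G x).
      { apply sumR_ext. intros i Hi. fold (g i x). rewrite Hvg by assumption. ring. }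
      assert (E2 : sumR p (fun i => c' i * dot m (g i x) (v x)) = 0).
      { rewrite <- Hc'. apply sumR_ext. intros i Hi. rewrite dot_sym, Hvg by assumption. ring. }
      rewrite E1, E2. apply normG2_pos in HV.
      assert (0 < a * normG2 p G x) by (apply Rmult_lt_0_compat; assumption). lra. }
  assert (HR : forall x, 0 <= R x) by (intros x; apply dot_self_ge0).
  set (s := fun x => sqrt (b x * b x + R x * R x)).
  exists (fun x k => (s x + b x) * v x k + (s x - b x) * r x k). split.
  - intros k Hk. fold U.
    assert (Sb : smooth_on m U b) by (apply (ff_dot _ _ m v gr FF); auto).
    assert (SR : smooth_on m U R) by (apply (ff_dot _ _ m r r FF); auto).
    assert (Ss : smooth_on m U s).
    { apply smooth_alg_smooth; [assumption|].
      apply (sa_sqrt m U (fun x => b x * b x + R x * R x)).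
      - apply sa_plus; apply sa_mult; apply sa_base; assumption.
      - intros x Hx Ux. apply blend_pos; [apply HR | auto]. }
    apply (ff_plus _ _ FF (fun x => (s x + b x) * v x k) (fun x => (s x - b x) * r x k)).
    + apply (ff_mult _ _ FF (fun x => s x + b x)); auto. apply (ff_plus _ _ FF); assumption.
    + apply (ff_mult _ _ FF (fun x => s x - b x)); auto.
      replace (fun x => s x - b x) with (fun x => s x + (-1) * b x) by (extensionality x; ring).
      apply (ff_plus _ _ FF); [assumption|].
      apply (ff_mult _ _ FF); [apply (ff_const _ _ FF) | assumption].
  - intros x Hx Ux. fold U in Ux.
    destruct (blend_pos (b x) (R x) (HR x) (Hb x Hx Ux)) as (_ & Hmu & Hpos). fold (s x) in *.
    set (nu := fun k => (s x + b x) * v x k + (s x - b x) * r x k).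
    (* DG carries nu to a positive multiple of G, a radial vector: Psi_G stays constant along nu and
       |G|^2 increases. *)
    assert (Hnu : forall k, (k < p)%nat -> dot m nu (grad m (G k) x) = (s x + b x) * G k x).
    { intros k Hk. fold (g k x). unfold nu. rewrite dot_comb_l, Hr by assumption.
      unfold v. rewrite Hc by auto. ring. }
    assert (HN : sumR p (fun l => G l x * dot m nu (grad m (G l) x))
                 = (s x + b x) * normG2 p G x).
    { unfold normG2. rewrite <- sumR_scal. apply sumR_ext; intros l Hl.
      rewrite Hnu by assumption. ring. }
    assert (PN := proj2 (normG2_pos p G x) (proj2 Ux)).
    split; [|split; [|split]].
    + intros k Hk. unfold nu, v, r.
      rewrite (inRm_lincomb m p (fun i => c i x)), (inRm_lincomb m p (fun i => d i x))
        by (assumption || (intros; apply inRm_grad)).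
      unfold gr. rewrite inRm_grad by assumption. ring.
    + intros i Hi. rewrite (dot_grad_Psi m p U) by (assumption || apply Ux).
      fold nu. rewrite HN, Hnu by assumption. assert (Hs := sqrt_lt_R0 _ PN). field. lra.
    + fold nu. fold gr. unfold nu. rewrite dot_comb_l, Hrr by assumption. exact Hpos.
    + fold nu. rewrite (dot_grad_normG2 m p U) by assumption. rewrite HN.
      apply Rmult_lt_0_compat; [lra|]. apply Rmult_lt_0_compat; assumption.
Qed.

(** Independence of the gradients gives v0 with DG(v0) = |G| u, and since u is orthogonal to Psi_G,
    v0 is mapped to u by the derivative of Psi_G. A multiple of nu, invisible to Psi_G, then adjusts
    the derivative of rho. *)
Lemma milnor_submersion (m p : nat) (G : nat -> pt -> R) (eps : R) (nu : pt -> pt) (x : pt) :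
  (forall i, (i < p)%nat -> smooth_on m (fun x => norm m x < eps) (G i)) ->
  milnor_vf m p G eps nu -> inRm m x -> norm m x < eps -> ~ VG p G x -> ~ SingG m p G x ->
  submersion_rhoPsi m p G x.
Proof.
  intros HG (_ & Hnu) Hx Hn HV HS s u Hu.
  destruct (Hnu x Hx (conj Hn HV)) as (Inu & Tnu & Rnu & _).
  assert (Ind : independent m p (fun i => grad m (G i) x))
    by (apply not_dependent_independent; exact HS).
  set (N := sqrt (normG2 p G x)).
  destruct (independent_solve m p _ (fun k => N * u k) Ind) as (c & Hc).
  set (v0 := lincomb p c (fun i => grad m (G i) x)) in *.
  set (t := (s - dot m v0 (grad m (rho m) x)) / dot m (nu x) (grad m (rho m) x)).
  exists (fun k => 1 * v0 k + t * nu x k). split; [|split].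
  - intros k Hk. unfold v0.
    rewrite inRm_lincomb, Inu by (assumption || (intros; apply inRm_grad)). ring.
  - rewrite dot_sym, dot_comb_l. unfold t. field. lra.
  - intros i Hi. rewrite dot_sym, dot_comb_l.
    rewrite (dot_sym m (nu x)), Tnu, (dot_sym m v0) by assumption.
    rewrite (dot_grad_Psi m p (fun x => norm m x < eps)) by assumption.
    assert (PN := proj2 (normG2_pos p G x) HV). assert (Hs := sqrt_lt_R0 _ PN). fold N in Hs |- *.
    rewrite Hc by assumption.
    assert (Z : sumR p (fun l => G l x * dot m v0 (grad m (G l) x)) = 0).
    { rewrite (sumR_ext p _ (fun l => N * N * (u l * Psi p G l x))).
      - rewrite sumR_scal. unfold dot in Hu. rewrite Hu. ring.
      - intros l Hl. rewrite Hc by assumption. unfold Psi. fold N. field. lra. }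
    rewrite Z. field. lra.
Qed.

(** * Choice of radii and conclusion *)

Lemma common_radius (m p : nat) (G : nat -> pt -> R) :
  (forall i, (i < p)%nat -> analytic_at0 m (G i)) ->
  exists r, 0 < r /\ forall i, (i < p)%nat -> smooth_on m (fun x => norm m x < r) (G i).
Proof.
  induction p as [|p IH]; intros H; [exists 1; split; [lra | lia]|].
  destruct IH as (r1 & Hr1 & H1); [intros; apply H; lia|].
  destruct (analytic_smooth m (G p) (H p ltac:(lia))) as (r2 & Hr2 & H2).
  exists (Rmin r1 r2); split; [apply Rmin_pos; assumption|].
  assert (L1 := Rmin_l r1 r2). assert (L2 := Rmin_r r1 r2).
  intros i Hi. destruct (Nat.eq_dec i p) as [->|].
  - apply (smooth_mono m (fun x => norm m x < r2)); [intros; lra | assumption].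
  - apply (smooth_mono m (fun x => norm m x < r1)); [intros; lra | apply H1; lia].
Qed.

Theorem theorem4p3 (m p : nat) (G : nat -> pt -> R)
  (Hmp : (p < m)%nat) (Hp : (2 <= p)%nat)
  (Han : forall i, (i < p)%nat -> analytic_at0 m (G i))
  (H0 : forall i, (i < p)%nat -> G i zero_pt = 0)
  (HD : exists eps, 0 < eps /\ forall x, inRm m x -> norm m x < eps ->
          MG m p G x -> ~ VG p G x -> ~ SingG m p G x ->
          forall j, (j < p)%nat -> G j x <> 0 -> 0 < det p (Dmat m p G j x)) :
  (exists eps, 0 < eps /\ forall x, inRm m x -> norm m x < eps ->
     MG m p G x -> ~ VG p G x -> ~ SingG m p G x -> 0 < acoef m p G x)
  /\ (DiscG_zero m p G ->
        (exists eps, 0 < eps /\ exists nu, milnor_vf m p G eps nu)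
        /\ rho_regular m p G).
Proof.
  destruct (common_radius m p G Han) as (r1 & Hr1 & HG1).
  destruct HD as (r2 & Hr2 & HD).
  set (r := Rmin r1 r2).
  assert (Hr : 0 < r) by (apply Rmin_pos; assumption).
  assert (L1 : r <= r1) by apply Rmin_l. assert (L2 : r <= r2) by apply Rmin_r.
  split.
  - exists r; split; [assumption|]. intros x Hx Hn HM HV HS.
    apply (acoef_pos m p G (fun x => norm m x < r1)); try assumption; try lra.
    + apply (MG_depset m p G (fun x => norm m x < r1)); try assumption; [|lra].
      apply ball_open; assumption.
    + apply HD; try assumption; lra.
  - intros (Sing0 & r3 & Hr3 & HS).
    set (e := Rmin r r3).
    assert (He : 0 < e) by (apply Rmin_pos; assumption).
    assert (E1 : e <= r) by apply Rmin_l. assert (E2 : e <= r3) by apply Rmin_r.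
    assert (HG : forall i, (i < p)%nat -> smooth_on m (fun x => norm m x < e) (G i)).
    { intros i Hi. apply (smooth_mono m (fun x => norm m x < r1)); [intros; lra | auto]. }
    assert (HNS : forall x, inRm m x -> norm m x < e -> ~ VG p G x -> ~ SingG m p G x).
    { intros x Hx Hn HV HSx. apply HV, HS; try assumption; lra. }
    destruct (milnor_vf_exists m p G e He HG HNS) as (nu & Hnu).
    { intros x Hx Hn HV Hdep. exists (acoef m p G x). apply and_comm.
      apply (acoef_pos m p G (fun x => norm m x < e)); auto.
      (* A dependence at x puts x in the closure M(G), since x approximates itself. *)
      apply HD; auto; [lra|]. intros d Hd. exists x. split; [assumption|]. split; [|assumption].
      rewrite norm_zero; [assumption | intros; ring]. }
    split; [exists e; split; [assumption | exists nu; assumption]|].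
    exists e; split; [assumption|]. intros x Hx Hn HM.
    (* Off V_G, failures of submersion accumulating at x would occur inside the ball, against
       [milnor_submersion]. *)
    assert (HV : VG p G x).
    { apply NNPP; intros HV.
      destruct (punctured_open m p G _ (ball_open m e He) HG x Hx (conj Hn HV)) as (d & Hd & H).
      destruct (HM d Hd) as (y & Hy & Hny & HVy & Hsub).
      destruct (H y Hy Hny) as (Hn' & _).
      apply Hsub, (milnor_submersion m p G e nu); auto. }
    (* G vanishes at x and at 0, and 0 is singular, so 0 witnesses that G(x) lies in Disc G. *)
    exists zero_pt. split; [intros i _; reflexivity|]. split; [|split; [assumption|]].
    + rewrite norm_zero; [assumption | reflexivity].
    + intros i Hi. rewrite H0, HV by assumption; reflexivity.
Qed.
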